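(* Let $e\ge1$ and $r\ge2$ be integers and let $B=B(2e,e,r)$. Write $\mathbb{Z}_n=\mathbb{Z}/n\mathbb{Z}$. Then: \begin{itemize} \item if $r=2$ and $e$ is odd, then $H_2(B,\mathbb{Z})\simeq\mathbb{Z}$; \item if $r=2$ and $e$ is even, then $H_2(B,\mathbb{Z})\simeq\mathbb{Z}^2$; \item if $r=3$, then $H_2(B,\mathbb{Z})\simeq\mathbb{Z}^2$; \item if $r=4$ and $e$ is odd, then $H_2(B,\mathbb{Z})\simeq\mathbb{Z}^2\times\mathbb{Z}_2$; \item if $r=4$ and $e$ is even, then $H_2(B,\mathbb{Z})\simeq\mathbb{Z}^2\times\mathbb{Z}_2^2$; \item if $r\ge5$, then $H_2(B,\mathbb{Z})\simeq\mathbb{Z}^2\times\mathbb{Z}_2$. \end{itemize}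
   Context: $G(2e,e,r)\subset GL_r(\mathbb{C})$ is the group of monomial $r\times r$ matrices whose nonzero entries are $2e$-th roots of unity with product equal to $\pm1$. The complex braid group is $B(2e,e,r)=\pi_1(X/G(2e,e,r))$ where $X=\{z\in\mathbb{C}^r: z_i\ne0 \text{ for all } i,\ z_i^{2e}\neq z_j^{2e}\text{ for } i\neq j\}$. Equivalently (known, Broué–Malle–Rouquier), let $\mathrm{A}_{\mathbf{B}_r}$ be the Artin group of type $\mathbf{B}_r$, with generators $\overline{\sigma}_1,\sigma_2,\dots,\sigma_r$ and relations $\overline\sigma_1\sigma_2\overline\sigma_1\sigma_2=\sigma_2\overline\sigma_1\sigma_2\overline\sigma_1$, $\sigma_i\sigma_{i+1}\sigma_i=\sigma_{i+1}\sigma_i\sigma_{i+1}$ for $i\ge2$, and commutation of non-consecutive generators; then $B(2e,e,r)$ is isomorphic to the kernel of the morphism $\mathrm{A}_{\mathbf{B}_r}\to\mathbb{Z}/e$ sending $\overline\sigma_1\mapsto1$ and $\sigma_i\mapsto0$ for $i>1$. Homology is group homology with trivial coefficients. *)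

(* Defs.v *)
From HB Require Import structures.
From mathcomp Require Import all_boot all_order all_algebra all_fingroup.
From mathcomp Require Import generic_quotient ring_quotient freeg boolp zify.

Set Implicit Arguments.
Unset Strict Implicit.
Unset Printing Implicit Defensive.

Import GRing.Theory.

Local Open Scope ring_scope.
Local Open Scope quotient_scope.

(* Group presentations.  A letter (i, b) stands for the generator i when b is
   false and for its inverse when b is true. *)
Section Presentation.
Variable I : choiceType.

Definition word := seq (I * bool).

Definition inv_word (u : word) : word := rev [seq (a.1, ~~ a.2) | a <- u].

Definition positive_word (s : seq I) : word := [seq (i, false) | i <- s].

Variable R : word -> word -> Prop.

Inductive pres_eq : word -> word -> Prop :=
| pres_eq_refl u : pres_eq u u
| pres_eq_sym u v : pres_eq u v -> pres_eq v u
| pres_eq_trans v u w : pres_eq u v -> pres_eq v w -> pres_eq u w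
| pres_eq_cat u u' v v' : pres_eq u u' -> pres_eq v v' ->
    pres_eq (u ++ v) (u' ++ v')
| pres_eq_cancel i b : pres_eq [:: (i, b); (i, ~~ b)] [::]
| pres_eq_rel u v : R u v -> pres_eq u v.

Definition pres_eqb (u v : word) : bool := `[< pres_eq u v >].

Lemma pres_eqb_equiv : equiv_class_of pres_eqb.
Proof.
split=> [u | u v | v u w].
- exact/asboolP/pres_eq_refl.
- by apply/asboolP/asboolP; apply: pres_eq_sym.
- by move=> /asboolP uv /asboolP vw; apply/asboolP/(pres_eq_trans uv vw).
Qed.

Canonical pres_eqb_equivRel := EquivRelPack pres_eqb_equiv.
Canonical pres_eqb_encModRel := defaultEncModRel pres_eqb.

Definition pres := {eq_quot pres_eqb}.

HB.instance Definition _ : EqQuotient word pres_eqb pres := EqQuotient.on pres.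
HB.instance Definition _ := Choice.on pres.

Definition pres_class (u : word) : pres := \pi_pres u.

Lemma pres_classP u v : reflect (pres_eq u v) (pres_class u == pres_class v).
Proof. by rewrite /pres_class piE; apply: asboolP. Qed.

Lemma pres_class_eq u v : pres_eq u v -> pres_class u = pres_class v.
Proof. by move=> uv; apply/eqP/pres_classP. Qed.

Lemma pres_eq_repr u : pres_eq (repr (pres_class u)) u.
Proof. by apply/pres_classP; rewrite /pres_class reprK. Qed.

Lemma pres_class_surj (x : pres) : exists u, x = pres_class u.
Proof. by exists (repr x); rewrite /pres_class reprK. Qed.

Definition pres_mul (x y : pres) : pres := pres_class (repr x ++ repr y).
Definition pres_one : pres := pres_class [::].
Definition pres_inv (x : pres) : pres := pres_class (inv_word (repr x)).

Lemma pres_mulE u v :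
  pres_mul (pres_class u) (pres_class v) = pres_class (u ++ v).
Proof. by apply: pres_class_eq; apply: pres_eq_cat; apply: pres_eq_repr. Qed.

Lemma inv_wordK : involutive inv_word.
Proof.
move=> u; rewrite /inv_word map_rev revK -map_comp -[RHS]map_id.
by apply: eq_map => -[i b] /=; rewrite negbK.
Qed.

Lemma pres_eq_mulV u : pres_eq (u ++ inv_word u) [::].
Proof.
elim: u => [|[i b] u IHu]; first exact: pres_eq_refl.
have -> : ((i, b) :: u) ++ inv_word ((i, b) :: u) =
    [:: (i, b)] ++ (u ++ inv_word u) ++ [:: (i, ~~ b)].
  by rewrite /inv_word /= rev_cons -cats1 catA.
apply: (@pres_eq_trans ([:: (i, b)] ++ [::] ++ [:: (i, ~~ b)])).
  apply: pres_eq_cat; first exact: pres_eq_refl.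
  by apply: pres_eq_cat; last exact: pres_eq_refl.
exact: pres_eq_cancel.
Qed.

Lemma pres_mulA : associative pres_mul.
Proof.
move=> x y z; have [u ->] := pres_class_surj x.
have [v ->] := pres_class_surj y; have [w ->] := pres_class_surj z.
by rewrite !pres_mulE catA.
Qed.

Lemma pres_mul1 : left_id pres_one pres_mul.
Proof. by move=> x; have [u ->] := pres_class_surj x; rewrite pres_mulE. Qed.

Lemma pres_mulr1 : right_id pres_one pres_mul.
Proof.
by move=> x; have [u ->] := pres_class_surj x; rewrite pres_mulE cats0.
Qed.

Lemma pres_mulVx : left_inverse pres_one pres_inv pres_mul.
Proof.
move=> x; rewrite -{2}[x]reprK -/(pres_class _) pres_mulE.
apply: pres_class_eq; rewrite -{2}[repr x]inv_wordK; exact: pres_eq_mulV.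
Qed.

Lemma pres_mulxV : right_inverse pres_one pres_inv pres_mul.
Proof.
move=> x; rewrite -{1}[x]reprK -/(pres_class _) pres_mulE.
exact/pres_class_eq/pres_eq_mulV.
Qed.

HB.instance Definition _ :=
  isGroup.Build pres pres_mulA pres_mul1 pres_mulr1 pres_mulVx pres_mulxV.

End Presentation.

Definition pres_gen (I : choiceType) (R : word I -> word I -> Prop) (i : I) :
  pres R := pres_class R [:: (i, false)].

(* The morphism out of a presented group that is prescribed on generators. *)
Section PresLift.
Variables (I : choiceType) (R : word I -> word I -> Prop) (H : groupType).
Variable f : I -> H.

Definition word_eval (u : word I) : H :=
  \big[*%g/1%g]_(a <- u) (if a.2 then (f a.1)^-1%g else f a.1).

Hypothesis fR : forall u v, R u v -> word_eval u = word_eval v.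

Lemma word_eval_pres_eq u v : pres_eq R u v -> word_eval u = word_eval v.
Proof.
elim=> // {u v} [u v w _ -> _ -> | u u' v v' _ IHu _ IHv | i b] //.
- by rewrite /word_eval !big_cat /= -!/(word_eval _) IHu IHv.
- rewrite /word_eval !big_cons big_nil /= mulg1.
  by case: b; rewrite /= ?mulVg ?mulgV.
Qed.

(* fR is an argument, although unused, to let the morphism structure be
   inferred. *)
Definition pres_lift of (forall u v, R u v -> word_eval u = word_eval v) :=
  fun x : pres R => word_eval (repr x).

Lemma pres_lift_class u : pres_lift fR (pres_class R u) = word_eval u.
Proof. exact/word_eval_pres_eq/pres_eq_repr. Qed.

Lemma pres_lift_gen i : pres_lift fR (pres_gen R i) = f i.
Proof. by rewrite pres_lift_class /word_eval big_seq1. Qed.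

Lemma pres_lift_monoid_morphism : monoid.monoid_morphism (pres_lift fR).
Proof.
split; first by rewrite [LHS]pres_lift_class /word_eval big_nil.
move=> x y; have [u ->] := pres_class_surj x.
have [v ->] := pres_class_surj y.
by rewrite [(_ * _)%g]pres_mulE !pres_lift_class /word_eval big_cat.
Qed.

HB.instance Definition _ :=
  isUMagmaMorphism.Build (pres R) H (pres_lift fR) pres_lift_monoid_morphism.

End PresLift.

Section Kernel.
Variables (G H : groupType) (f : UMagmaMorphism.type G H).

Definition ker_pred : {pred G} := [pred x | f x == 1%g].

Lemma ker_group_closed : group_closed ker_pred.
Proof.
split; first by rewrite inE gmulf1.
by move=> x y /eqP fx /eqP fy; rewrite inE gmulfF fx fy divgg.
Qed.

Definition ker := {x : G | x \in ker_pred}.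

HB.instance Definition _ := SubChoice.on ker.
HB.instance Definition _ :=
  SubChoice_isSubGroup.Build G ker_pred ker ker_group_closed.

End Kernel.

(* Group homology with coefficients in the trivial module int, computed by the
   inhomogeneous bar complex: C_n is the free abelian group on G^n, and
   d [g_1 | ... | g_(n+1)] = [g_2 | ... | g_(n+1)]
     + \sum_(1 <= i <= n) (-1)^i [g_1 | ... | g_i g_(i+1) | ... | g_(n+1)]
     + (-1)^(n+1) [g_1 | ... | g_n]. *)
Section Homology.
Variable G : groupType.

Definition bar_chain n := {freeg (n.-tuple G) / int}.

(* bar_face i is the i-th of the n + 2 faces above: entries are numbered from
   0, so it drops the first entry if i = 0, multiplies entries i - 1 and i if
   0 < i <= n, and drops the last entry if i = n + 1. *)
Definition bar_face n (i : nat) (t : n.+1.-tuple G) : n.-tuple G :=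
  [tuple let a := tnth t (widen_ord (leqnSn n) j) in
         let b := tnth t (fintype.lift ord0 j) in
         if (j.+1 < i)%N then a else if j.+1 == i then (a * b)%g else b
    | j < n].

Definition bar_d n : bar_chain n.+1 -> bar_chain n :=
  fglift (fun t => \sum_(i < n.+2) Freeg [:: ((-1) ^+ i, bar_face i t)]).

Lemma bar_d_zmod_morphism n : zmod_morphism (@bar_d n).
Proof. exact: lift_is_additive. Qed.

HB.instance Definition _ n := GRing.isZmodMorphism.Build
  (bar_chain n.+1) (bar_chain n) (@bar_d n) (@bar_d_zmod_morphism n).

Lemma nth_bar_face n i (t : n.+1.-tuple G) k : (k < n)%N ->
  nth 1%g (bar_face i t) k =
    if (k.+1 < i)%N then nth 1%g t k
    else if k.+1 == i then (nth 1%g t k * nth 1%g t k.+1)%g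
    else nth 1%g t k.+1.
Proof.
move=> lt_kn; rewrite -[k]/(nat_of_ord (Ordinal lt_kn)) -tnth_nth tnth_mktuple.
by rewrite !(tnth_nth 1%g) /=.
Qed.

Lemma bar_face_face n i j (t : n.+2.-tuple G) : (i <= j)%N ->
  bar_face j (bar_face i t) = bar_face i (bar_face j.+1 t).
Proof.
move=> le_ij; apply: val_inj; apply: (@eq_from_nth _ 1%g) => [|k].
  by rewrite !size_tuple.
rewrite size_tuple => lt_kn; have lt_kn1 := ltnW lt_kn : (k < n.+1)%N.
rewrite !nth_bar_face ?ltnS //.
by repeat case: ifPn => ?; rewrite ?mulgA //; exfalso; lia.
Qed.

Lemma alternating_sum0 (V : zmodType) (F : nat -> nat -> V) m :
    (forall i j, (i <= j)%N -> F i j = - F j.+1 i) ->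
  \sum_(i < m.+1) \sum_(j < m) F i j = 0.
Proof.
move=> antiF.
under eq_bigr => i _ do rewrite (bigID (fun j : 'I_m => (i <= j)%N)) /=.
rewrite big_split /= big_ord_recr /= [X in _ + X + _]big_pred0; last first.
  by move=> j; rewrite leqNgt ltn_ord.
rewrite addr0 big_ord_recl /= [X in _ + (X + _)]big_pred0; last by move=> j.
rewrite add0r; under eq_bigr => i _ do rewrite big_mkcond /=.
rewrite exchange_big /= -big_split /= big1 // => i _.
rewrite [X in _ + X]big_mkcond -big_split big1 //= => j _.
rewrite /bump /= add1n -ltnNge ltnS; case: ifP => [le_ji | _]; last exact: addr0.
by rewrite antiF ?addNr.
Qed.

Lemma bar_dU n k (t : n.+1.-tuple G) :
  bar_d (Freeg [:: (k, t)]) =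
    \sum_(i < n.+2) Freeg [:: ((-1) ^+ i, bar_face i t)] *~ k.
Proof. by rewrite /bar_d liftU -[k in LHS]intz scaler_int mulrz_suml. Qed.

Lemma bar_d_bar_d n (c : bar_chain n.+2) : bar_d (bar_d c) = 0.
Proof.
rewrite -[c]freeg_sumE !raddf_sum big1 //= => t _.
rewrite bar_dU -mulrz_suml raddfMz raddf_sum /=.
under eq_bigr => i _ do rewrite bar_dU.
rewrite (@alternating_sum0 _ (fun i j =>
  Freeg [:: ((-1) ^+ j, bar_face j (bar_face i t))] *~ (-1) ^+ i)) ?mul0rz //.
move=> i j le_ij; rewrite bar_face_face // !freeg_mulz freegUN.
rewrite exprS mulN1r mulrNz opprK.
rewrite -[X in (X, _)]mulrzr -[X in _ = Freeg [:: (X, _)]]mulrzr.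
by rewrite !intz mulrC.
Qed.

Definition bar_cycle n : {pred bar_chain n} :=
  match n with
  | 0 => fun=> true
  | m.+1 => fun c => bar_d c == 0
  end.

Lemma bar_cycle_zmod_closed n : zmod_closed (@bar_cycle n).
Proof.
case: n => [|n]; split=> //; first by rewrite unfold_in /= raddf0.
move=> x y; rewrite !unfold_in /= => /eqP dx /eqP dy.
by rewrite bar_d_zmod_morphism dx dy subr0.
Qed.

HB.instance Definition _ n :=
  GRing.isZmodClosed.Build (bar_chain n) (@bar_cycle n)
    (@bar_cycle_zmod_closed n).

Definition bar_cycles n := {c : bar_chain n | c \in @bar_cycle n}.

HB.instance Definition _ n := SubChoice.on (bar_cycles n).
HB.instance Definition _ n :=
  [SubChoice_isSubZmodule of bar_cycles n by <:].

Definition bar_boundary n : {pred bar_cycles n} :=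
  fun z => `[< exists c : bar_chain n.+1, val z = bar_d c >].

Lemma bar_boundary_zmod_closed n : zmod_closed (@bar_boundary n).
Proof.
split; first by apply/asboolP; exists 0; rewrite !raddf0.
move=> x y /asboolP[c xE] /asboolP[c' yE]; apply/asboolP; exists (c - c').
by rewrite bar_d_zmod_morphism -xE -yE; exact: raddfB.
Qed.

HB.instance Definition _ n :=
  GRing.isZmodClosed.Build (bar_cycles n) (@bar_boundary n)
    (@bar_boundary_zmod_closed n).

Definition group_homology n := Quotient.quot (@bar_boundary n).

HB.instance Definition _ n := GRing.Zmodule.on (group_homology n).

End Homology.

Definition zmod_iso (V W : zmodType) : Prop :=
  exists f : {additive V -> W}, bijective f.

(* The Artin group of type B_r: the generators are indexed by 'I_r, the index 0
   being that of \bar\sigma_1 and the index i > 0 that of \sigma_(i+1). *)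
Inductive artin_B_rel r : word 'I_r -> word 'I_r -> Prop :=
| artin_B_braid4 (i j : 'I_r) : i = 0%N :> nat -> j = 1%N :> nat ->
    artin_B_rel (positive_word [:: i; j; i; j]) (positive_word [:: j; i; j; i])
| artin_B_braid3 (i j : 'I_r) : (0 < i)%N -> j = i.+1 :> nat ->
    artin_B_rel (positive_word [:: i; j; i]) (positive_word [:: j; i; j])
| artin_B_comm (i j : 'I_r) : (i.+1 < j)%N ->
    artin_B_rel (positive_word [:: i; j]) (positive_word [:: j; i]).

Definition artin_B r := pres (@artin_B_rel r).

HB.instance Definition _ r := Group.on (artin_B r).

(* Z/e is represented by 'I_(e.-1).+1, which for e > 0 is the additive group of
   integers modulo e (for e = 1 included, unlike 'Z_e). *)
Definition artin_B_winding_gen e r (i : 'I_r) : 'I_e.-1.+1 :=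
  if i == 0%N :> nat then inZp 1 else inZp 0.

Lemma artin_B_winding_rel e r (u v : word 'I_r) : artin_B_rel u v ->
  word_eval (artin_B_winding_gen e (r := r)) u =
  word_eval (artin_B_winding_gen e (r := r)) v.
Proof.
have mC (x y : 'I_e.-1.+1) : (x * y)%g = (y * x)%g by exact: Zp_mulgC.
case=> {u v} i j;
  rewrite /word_eval /positive_word /= !big_cons big_nil !mulg1 /=.
- by move=> _ _; rewrite mC !mulgA.
- by move=> i0 jE; rewrite /artin_B_winding_gen jE /= eqn0Ngt i0 /=.
- by move=> _; rewrite mC.
Qed.

(* The morphism A_(B_r) -> Z/e with \bar\sigma_1 |-> 1 and \sigma_i |-> 0 for
   i > 1. *)
Definition artin_B_winding e r : artin_B r -> 'I_e.-1.+1 :=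
  pres_lift (@artin_B_winding_rel e r).

HB.instance Definition _ e r := UMagmaMorphism.on (@artin_B_winding e r).

Lemma artin_B_winding_genE e r (i : 'I_r) :
  artin_B_winding e (pres_gen (@artin_B_rel r) i) = artin_B_winding_gen e i.
Proof. exact: pres_lift_gen. Qed.

(* B(2e,e,r) = pi_1(X/G(2e,e,r)), in its description as a finite-index subgroup
   of the Artin group of type B_r due to Broue, Malle and Rouquier. *)
Definition complex_braid_group e r := ker (@artin_B_winding e r).

HB.instance Definition _ e r := Group.on (complex_braid_group e r).

(* Main.v *)
Require Import Defs.
From mathcomp Require Import all_boot all_order all_algebra.
From HB Require Import structures.
From mathcomp Require Import all_fingroup.
From mathcomp Require Import generic_quotient ring_quotient freeg boolp.
From mathcomp Require Import zify ring.

(* H_2(K) is computed from central extensions only, without an aspherical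
   complex. Let a = \bar\sigma_1. The kernel K is generated by al = a^e and the
   y_(k,i) = a^k \sigma_(i+1) a^-k, with the relations of kernel_rels.

   Let Q be the quotient of the bar 2-chains by the boundaries. The tautological
   2-cocycle [g|h] defines the universal central extension E of K by Q, and
   H_2(K) is the kernel of Q -> C_1. Lifting the generators to E, the defects of
   the relations of K become elements of Q. For r >= 3, once the lifts are
   chosen so that the braid relations hold exactly, all defects are multiples of
   the commutator of the lifts of al and \sigma_3 (a torus), of the defect of
   y_(k+1,1) y_(k+2,1) = y_(k,1) y_(k+1,1), and of commutators of pairs of
   generators, which are of order 2 because such a pair is exchanged by a
   conjugation; for r = 2 they are defects of the conjugation by al.

   Independence is shown by functionals Q -> Z and Q -> Z/2, each coming from
   a projective morphism of K: to a group of substitutions of Laurent monomials,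
   up to powers of q, or to a group of units of a Clifford algebra over F_3, up
   to sign. Let j send a basis of the target A to the chosen classes and
   phi : Q -> A be the dual functional. Pushing the cocycle forward along
   id - j phi kills all the classes, so the resulting extension splits; hence
   id - j phi vanishes on cycles, and phi induces an isomorphism H_2(K) -> A. *)

Set Implicit Arguments.
Unset Strict Implicit.
Unset Printing Implicit Defensive.

Import GRing.Theory.

Local Open Scope group_scope.

(** * A presentation of the kernel *)

(** The step is an equivalence so that one induction runs in both directions along the integers; in
    a group the converse implications come from cancellation. *)
Lemma int_step_ind (P : int -> Prop) :
  P 0%R -> (forall m, P m <-> P (m + 1)%R) -> forall m, P m.
Proof.
move=> P0 PS; apply: (int_ind P0) => n IHn.
  by rewrite -addn1 PoszD; apply: (proj1 (PS n)).
by apply: (proj2 (PS _)); rewrite -addn1 PoszD opprD addrNK.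
Qed.

Section IntegerPowers.
Variable H : groupType.
Implicit Types (x y : H) (m n : int).

Definition zpow x m : H :=
  match m with Posz n => x ^+ n | Negz n => x ^- n.+1 end.

Lemma zpow1 x : zpow x 1 = x.
Proof. exact: expg1. Qed.

Lemma zpowS x m : zpow x (m + 1)%R = zpow x m * x.
Proof.
case: m => [n|[|n]]; first by rewrite -PoszD addn1 /= expgSr.
  by rewrite NegzE addNr /= expg1 mulVg.
have -> : (Negz n.+1 + 1)%R = Negz n by rewrite !NegzE; lia.
by rewrite /= [x ^+ n.+2]expgS invgM mulgVK.
Qed.

Lemma zpowD x m n : zpow x (m + n)%R = zpow x m * zpow x n.
Proof.
elim/int_step_ind: n => [|n]; first by rewrite addr0 mulg1.
rewrite addrA !zpowS mulgA; split=> [-> //|]; exact: mulIg.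
Qed.

Lemma zpowSl x m : zpow x (m + 1)%R = x * zpow x m.
Proof. by rewrite addrC zpowD zpow1. Qed.

Lemma zpowN x m : zpow x (- m)%R = (zpow x m)^-1.
Proof. by apply: (@mulgI _ (zpow x m)); rewrite -zpowD subrr mulgV. Qed.

Lemma commute_zpow x y m : commute x y -> commute x (zpow y m).
Proof. by case: m => n xy; [|apply: commuteV]; apply: commuteX. Qed.

Lemma zpow_zpow x (n : nat) m : zpow x (m * n)%R = zpow (x ^+ n) m.
Proof.
elim/int_step_ind: m => [|m]; first by rewrite mul0r.
rewrite mulrDl mul1r zpowS zpowD /=; split=> [-> //|]; exact: mulIg.
Qed.
End IntegerPowers.

Section Morphism.
Variables (H H' : groupType) (f : H -> H').
Hypothesis fM : {morph f : x y / x * y}.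

Lemma morph_one : f 1 = 1.
Proof. by apply: (@mulgI _ (f 1)); rewrite -fM !mulg1. Qed.

Lemma morph_inv x : f x^-1 = (f x)^-1.
Proof. by apply: (@mulgI _ (f x)); rewrite -fM !mulgV morph_one. Qed.

Lemma morph_conj x y : f (x ^ y) = f x ^ f y.
Proof. by rewrite !conjgE !fM morph_inv. Qed.

Lemma morph_comm x y : f [~ x, y] = [~ f x, f y].
Proof. by rewrite !commgEl fM morph_inv morph_conj. Qed.

Lemma morph_exp x n : f (x ^+ n) = f x ^+ n.
Proof. by elim: n => [|n IHn]; rewrite ?morph_one // !expgS fM IHn. Qed.

Lemma morph_zpow x m : f (zpow x m) = zpow (f x) m.
Proof. by case: m => n /=; rewrite ?morph_inv morph_exp. Qed.
End Morphism.

(* A presentation of the kernel of A_(B_r) -> Z/e: y k i stands for the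
   conjugate a^k \sigma_(i+1) a^-k, where a = \bar\sigma_1 and 0 < i < r, and
   al stands for a^e. *)
Record kernel_rels e r (H : groupType) (al : H) (y : int -> nat -> H) : Prop :=
  KernelRels {
  rel_quad k : y (k + 1)%R 1%N * y (k + 2)%R 1%N = y k 1%N * y (k + 1)%R 1%N;
  rel_shift k i : 1 < i < r -> y (k + 1)%R i = y k i;
  rel_braid k i : 0 < i -> i.+1 < r ->
    y k i * y k i.+1 * y k i = y k i.+1 * y k i * y k i.+1;
  rel_comm k i j : 0 < i -> i.+1 < j -> j < r -> commute (y k i) (y k j);
  rel_conj k i : 0 < i < r -> al * y k i = y (k + e)%R i * al }.

(** [rel_quad] at [k = 0] is the relation of length 4 multiplied on the right by [a ^- 2]. The group
    is arbitrary because the lemma serves both the Artin group and a group of substitutions modulo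
    powers of q. *)
Lemma artin_kernel_rels (e r : nat) (H : groupType) (a : H) (sg : nat -> H) :
  a * sg 1%N * a * sg 1%N = sg 1%N * a * sg 1%N * a ->
  (forall i, 1 < i < r -> commute a (sg i)) ->
  (forall i, 0 < i -> i.+1 < r ->
    sg i * sg i.+1 * sg i = sg i.+1 * sg i * sg i.+1) ->
  (forall i j, 0 < i -> i.+1 < j -> j < r -> commute (sg i) (sg j)) ->
  kernel_rels e r (a ^+ e) (fun k i => zpow a k * sg i * (zpow a k)^-1).
Proof.
move=> quad a_sg braid comm.
have conjE k i : zpow a k * sg i * (zpow a k)^-1 = sg i ^ (zpow a k)^-1.
  by rewrite conjgE invgK mulgA.
split.
- move=> k; have -> : (k + 2 = k + 1 + 1)%R by lia.
  rewrite !zpowS; move: (zpow a k) => z.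
  rewrite !invgM !mulgA !mulgVK; apply: (@mulIg _ (z * a * a)).
  rewrite !mulgA !mulgVK.
  by move: quad; rewrite -!mulgA => ->.
- move=> k i ir; rewrite zpowS invgM !mulgA; congr (_ * _).
  by rewrite -(mulgA _ a) (a_sg i ir) mulgA mulgK.
- by move=> k i i0 ir; rewrite !conjE -!conjMg braid.
- by move=> k i j i0 ij jr; rewrite /commute !conjE -!conjMg comm.
move=> k i ir; rewrite -[a ^+ e]/(zpow a e) [(k + e)%R]addrC zpowD invgM !mulgA.
by rewrite mulgVK.
Qed.

(** * Rewriting words of the Artin group in the generators of the kernel *)

Section Evaluation.
Variables (e r : nat).
Hypothesis r_gt1 : 1 < r.
Implicit Types u v : word 'I_r.

Fixpoint winding u : int :=
  if u is (i, b) :: u' then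
    ((if i == 0%N :> nat then (if b then -1 else 1) else 0) + winding u')%R
  else 0%R.

Lemma winding_cat u v : winding (u ++ v) = (winding u + winding v)%R.
Proof. by elim: u => [|[i b] u IHu] /=; rewrite ?add0r // IHu addrA. Qed.

Lemma winding_pres_eq u v : pres_eq (@artin_B_rel r) u v ->
  winding u = winding v.
Proof.
elim=> {u v} // [u v w _ -> _ -> | u u' v v' _ IHu _ IHv | i b | u v] //.
- by rewrite !winding_cat IHu IHv.
- by case: b => /=; case: ifP => _; rewrite addr0 ?addr0 ?addNr ?addrN.
case=> i j /=.
- by move=> -> ->; rewrite /=.
- by move=> i0 ->; case: eqP => [E|_] //=; move: i0; rewrite E.
- by move=> ij; rewrite !addr0 addrC.
Qed.

Section Target.
Variables (H : groupType) (al : H) (y : int -> nat -> H).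

(** Reidemeister-Schreier rewriting along the powers of a: [k] is the exponent of a accumulated so
    far, and a letter [i > 0] met at that point stands for its conjugate by a^k, that is, for
    [y k i]. *)
Fixpoint kernel_eval (k : int) u : H :=
  if u is (i, b) :: u' then
    if i == 0%N :> nat then kernel_eval (k + (if b then -1 else 1))%R u'
    else (if b then (y k i)^-1 else y k i) * kernel_eval k u'
  else 1.

Lemma kernel_eval_cat k u v :
  kernel_eval k (u ++ v) = kernel_eval k u * kernel_eval (k + winding u)%R v.
Proof.
elim: u k => [|[i b] u IHu] k /=; first by rewrite mul1g addr0.
by case: ifP => _; rewrite IHu; [rewrite addrA | rewrite add0r mulgA].
Qed.

Hypothesis yP : kernel_rels e r al y.

Lemma kernel_eval_pres_eq u v : pres_eq (@artin_B_rel r) u v ->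
  forall k, kernel_eval k u = kernel_eval k v.
Proof.
elim=> {u v} // [u v w _ IH1 _ IH2 k | u u' v v' uu' IHu _ IHv k | i b k | u v
  uv k].
- by rewrite IH1.
- by rewrite !kernel_eval_cat (winding_pres_eq uu') IHu IHv.
- by case: b => /=; case: (_ == _); rewrite ?mulg1 ?mulVg ?mulgV.
case: uv => i j /=.
- move=> -> ->; rewrite /= !mulg1.
  have := rel_quad yP k.
  have -> : (k + 1 + 1 = k + 2)%R by lia.
  by [].
- move=> i0 jE; have ne0 : (i == 0%N :> nat) = false by case: eqP i0 => // ->.
  rewrite jE ne0 /= !mulg1 !mulgA; apply: (rel_braid yP) => //.
  by rewrite -jE.
move=> ij; have -> : (j == 0%N :> nat) = false by case: eqP ij => // ->.
case: eqP => i0; rewrite ?mulg1.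
  by rewrite (rel_shift yP) // ltn_ord andbT; rewrite i0 in ij.
apply: (rel_comm yP) => //; lia.
Qed.

Lemma conj_kernel_eval k u : al * kernel_eval k u =
  kernel_eval (k + e)%R u * al.
Proof.
elim: u k => [|[i b] u IHu] k /=; first by rewrite mulg1 mul1g.
case: eqP => i0; first by rewrite IHu addrAC.
have yC : al * y k i = y (k + e)%R i * al by apply: (rel_conj yP);
  rewrite lt0n ltn_ord andbT; apply/eqP.
case: b; last by rewrite mulgA yC -mulgA IHu mulgA.
rewrite mulgA -[al * _](mulKg (y (k + e)%R i)) [_ * (al * _)]mulgA -yC mulgK.
by rewrite -!mulgA IHu.
Qed.

Lemma conj_kernel_eval_zpow m k u :
  zpow al m * kernel_eval k u = kernel_eval (k + m * e)%R u * zpow al m.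
Proof.
elim/int_step_ind: m k => [k|m]; first by rewrite mul0r addr0 mul1g mulg1.
have shift k : (k + (m + 1) * e = k + m * e + e)%R by ring.
split=> E k.
  by rewrite shift zpowSl -mulgA E !mulgA conj_kernel_eval.
apply: (@mulgI _ al); rewrite mulgA -zpowSl E shift zpowSl.
by rewrite [RHS]mulgA conj_kernel_eval mulgA.
Qed.

End Target.

Lemma kernel_eval_morph (H H' : groupType) (f : H -> H') y k u :
  {morph f : x y / x * y} ->
  f (kernel_eval y k u) = @kernel_eval H' (fun k i => f (y k i)) k u.
Proof.
move=> fM; elim: u k => [|[i b] u IHu] k /=; first exact: morph_one.
by case: ifP => _; rewrite ?IHu ?fM ?IHu //; case: b; rewrite ?morph_inv.
Qed.

Lemma zpow_inZp1 m : 0 < e ->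
  zpow (inZp 1 : 'I_e.-1.+1) m = 1 -> exists q : int, m = (q * e%:Z)%R.
Proof.
move=> e_gt0.
have nE n : (inZp 1 : 'I_e.-1.+1) ^+ n = 1 -> exists q : nat, n = (q * e)%N.
  move=> /(congr1 val); rewrite Zp_expg /= modnMml mul1n prednK //.
  by move/eqP/dvdnP.
case: m => n /= => [|/eqP]; last rewrite invg_eq1 => /eqP.
  by move=> /nE[q ->]; exists q; rewrite PoszM.
by move=> /nE[q]; rewrite NegzE => ->; exists (- q%:Z)%R; rewrite PoszM mulNr.
Qed.

Definition artin_gen i : artin_B r :=
  oapp (pres_gen (@artin_B_rel r)) 1 (insub i).

Lemma artin_genE (i : 'I_r) : artin_gen i = pres_gen (@artin_B_rel r) i.
Proof. by rewrite /artin_gen valK. Qed.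

Local Notation K := (complex_braid_group e r).
Local Notation a := (artin_gen 0).
Local Notation W := (artin_B_winding e (r := r)).

Definition braid_al : K := insubd 1 (a ^+ e).
Definition braid_y (k : int) (i : nat) : K :=
  insubd 1 (zpow a k * artin_gen i * (zpow a k)^-1).

Hypothesis e_gt0 : 0 < e.

Lemma artin_B_winding_eval u :
  W (pres_class (@artin_B_rel r) u) = zpow (inZp 1) (winding u).
Proof.
rewrite [LHS]pres_lift_class /word_eval.
elim: u => [|[i b] u IHu]; rewrite ?big_nil // big_cons IHu zpowD /=.
have w0 : inZp 0 = 1 :> 'I_e.-1.+1 by apply: val_inj; rewrite /= mod0n.
congr (_ * _); rewrite /artin_B_winding_gen.
case: b; case: (_ == _) => //=.
by rewrite w0 invg1.
Qed.

Lemma artin_B_winding_gen0 : W a = inZp 1.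
Proof.
have r_gt0 := ltnW r_gt1.
by rewrite -[0%N]/(val (Ordinal r_gt0)) artin_genE artin_B_winding_genE.
Qed.

Lemma val_braid_al : val braid_al = a ^+ e.
Proof.
rewrite insubdK // inE gmulfXn /= artin_B_winding_gen0 Zp_expg.
by apply/eqP/val_inj; rewrite /= modnMml mul1n prednK // modnn.
Qed.

Lemma val_braid_y k i : 0 < i -> 
  val (braid_y k i) = zpow a k * artin_gen i * (zpow a k)^-1.
Proof.
move=> i_gt0; rewrite insubdK // inE !gmulfM gmulfV /=.
have -> : W (artin_gen i) = 1.
  rewrite /artin_gen; case: insubP => [j _ jE|_] /=; last exact: gmulf1.
  rewrite artin_B_winding_genE /artin_B_winding_gen jE.
  rewrite (negbTE (lt0n_neq0 i_gt0)).
  by apply: val_inj; rewrite /= mod0n.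
by rewrite mulg1 mulgV.
Qed.

Lemma pres_class_cat u v : pres_class (@artin_B_rel r) (u ++ v) =
  pres_class (@artin_B_rel r) u * pres_class (@artin_B_rel r) v.
Proof. by rewrite [RHS]pres_mulE. Qed.

Lemma pres_class_cons i b u : pres_class (@artin_B_rel r) ((i, b) :: u) =
  (if b then (artin_gen i)^-1 else artin_gen i) * pres_class (@artin_B_rel r) u.
Proof.
rewrite -cat1s pres_class_cat artin_genE; congr (_ * _).
case: b => //; apply: (@mulgI _ (pres_gen (@artin_B_rel r) i)).
by rewrite mulgV -pres_class_cat; apply: pres_class_eq; apply: pres_eq_cancel.
Qed.

Lemma artin_gen_rel (s t : seq 'I_r) :
  artin_B_rel (positive_word s) (positive_word t) ->
  foldr (fun i x => artin_gen (val i) * x) 1 s =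
  foldr (fun i x => artin_gen (val i) * x) 1 t.
Proof.
have wordE w : foldr (fun i x => artin_gen (val i) * x) 1 w =
    pres_class _ (positive_word w).
  by elim: w => //= i w ->;
    rewrite -[RHS]/(pres_class _ ((i, false) :: _)) pres_class_cons.
by move=> st; rewrite !wordE; apply/pres_class_eq/pres_eq_rel.
Qed.

Lemma artin_gen_quad :
  a * artin_gen 1 * a * artin_gen 1 = artin_gen 1 * a * artin_gen 1 * a.
Proof.
have := artin_gen_rel
  (@artin_B_braid4 r (Ordinal (ltnW r_gt1)) (Ordinal r_gt1) erefl erefl).
by rewrite /= !mulg1 !mulgA.
Qed.

Lemma artin_gen_braid i : 0 < i -> i.+1 < r ->
  artin_gen i * artin_gen i.+1 * artin_gen i =
  artin_gen i.+1 * artin_gen i * artin_gen i.+1.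
Proof.
move=> i_gt0 i1_lt; have := artin_gen_rel
  (@artin_B_braid3 r (Ordinal (ltnW i1_lt)) (Ordinal i1_lt) i_gt0 erefl).
by rewrite /= !mulg1 !mulgA.
Qed.

Lemma artin_gen_comm i j : i.+1 < j -> j < r ->
  commute (artin_gen i) (artin_gen j).
Proof.
move=> ij j_lt; have i_lt : i < r by lia.
have := artin_gen_rel (@artin_B_comm r (Ordinal i_lt) (Ordinal j_lt) ij).
by rewrite /= !mulg1.
Qed.

Fact val_kernelM (g h : K) : val (g * h) = val g * val h.
Proof. exact: gmulfM. Qed.

Fact val_kernelV (g : K) : val g^-1 = (val g)^-1.
Proof. exact: gmulfV. Qed.

Lemma kernel_braid_rels : kernel_rels e r braid_al braid_y.
Proof.
have [|||quad shift braid comm conj] :=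
  @artin_kernel_rels e r _ a artin_gen artin_gen_quad.
- by move=> i /andP[i1 ir]; apply: artin_gen_comm.
- exact: artin_gen_braid.
- by move=> i j _; apply: artin_gen_comm.
split.
- by move=> k; apply: val_inj; rewrite !val_kernelM !val_braid_y // quad.
- by move=> k i ir; apply: val_inj; rewrite !val_braid_y ?shift //; lia.
- by move=> k i i0 ir; apply: val_inj; rewrite !val_kernelM !val_braid_y ?braid.
- move=> k i j i0 ij jr; apply: val_inj; have j0 : 0 < j by lia.
  by rewrite !val_kernelM !val_braid_y //; apply: comm.
move=> k i ir; apply: val_inj; have /andP[i0 _] := ir.
by rewrite !val_kernelM val_braid_al !val_braid_y //; apply: conj.
Qed.

(** * The universal property of the presentation of the kernel *)

Section UniversalProperty.
Variables (H : groupType) (al : H) (y : int -> nat -> H).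
Hypothesis yP : kernel_rels e r al y.

(** A word for [g] equals the product of its rewritten letters times a power of a, whose exponent is
    the winding number. This is a multiple of [e] since [g] lies in the kernel, so the last factor
    is a power of [al]. *)
Definition kernel_lift (g : K) : H :=
  kernel_eval y 0 (repr (val g)) * zpow al (winding (repr (val g)) %/ e)%Z.

Lemma kernel_winding (g : K) u :
  pres_class (@artin_B_rel r) u = val g ->
    exists q : int, winding u = (q * e%:Z)%R.
Proof.
move=> uE; apply: zpow_inZp1 => //; rewrite -artin_B_winding_eval uE.
exact/eqP/(valP g).
Qed.

Lemma kernel_liftE (g : K) u q :
  pres_class (@artin_B_rel r) u = val g -> winding u = (q * e%:Z)%R ->
  kernel_lift g = kernel_eval y 0 u * zpow al q.
Proof.
move=> uE uq.
have ru : pres_eq (@artin_B_rel r) (repr (val g)) u.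
  by rewrite -uE; apply: pres_eq_repr.
rewrite /kernel_lift (kernel_eval_pres_eq yP ru) (winding_pres_eq ru) uq
  mulzK //.
lia.
Qed.

(** Moving the power of [al] that ends the value at [g] past the value at [h] shifts the starting
    exponent of the latter by the winding number of [g], which is where the concatenated word starts
    to read [h]. *)
Lemma kernel_liftM : {morph kernel_lift : g h / g * h}.
Proof.
move=> g h.
have [gE hE] : pres_class _ (repr (val g)) =
  val g /\ pres_class _ (repr (val h)) = val h.
  by rewrite /pres_class !reprK.
have [[m gm] [n hn]] := (kernel_winding gE, kernel_winding hE).
rewrite (kernel_liftE gE gm) (kernel_liftE hE hn).
rewrite (@kernel_liftE (g * h) (repr (val g) ++ repr (val h)) (m + n)%R).
- rewrite kernel_eval_cat gm add0r zpowD -!mulgA; congr (_ * _); rewrite !mulgA.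
  by rewrite (conj_kernel_eval_zpow yP) add0r.
- by rewrite pres_class_cat gE hE gmulfM.
by rewrite winding_cat gm hn mulrDl.
Qed.

Let a0 : 'I_r := Ordinal (ltnW r_gt1).

Fact power_word m : exists u, [/\ pres_class _ u = zpow a m, winding u = m &
  forall k, kernel_eval y k u = 1].
Proof.
have nE b n : exists u, [/\ pres_class _ u = (if b then a^-1 else a) ^+ n,
    winding u = (n%:Z * (if b then -1 else 1))%R & forall k, kernel_eval y k u
      = 1].
  elim: n => [|n [u [uE uw uy]]]; first by exists [::]; rewrite mul0r.
  exists ((a0, b) :: u); split=> [||k] /=; last exact: uy.
    by rewrite pres_class_cons uE expgS.
  by rewrite uw -addn1 PoszD mulrDl mul1r addrC.
case: m => n; first by have [u] := nE false n; rewrite mulr1; exists u.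
have [u] := nE true n.+1; rewrite expVgn NegzE mulrN1 => uP; by exists u.
Qed.

Lemma kernel_lift_al : kernel_lift braid_al = al.
Proof.
have [u [uE uw uy]] := power_word e.
rewrite (@kernel_liftE _ u 1%R) ?uy ?mul1g ?zpow1 //; last by rewrite mul1r.
by rewrite uE val_braid_al.
Qed.

Lemma kernel_lift_y k i : 0 < i < r -> kernel_lift (braid_y k i) = y k i.
Proof.
move=> /andP[i0 ir].
have [u [uE uw uy]] := power_word k; have [v [vE vw vy]] := power_word (- k)%R.
rewrite (@kernel_liftE _ (u ++ (Ordinal ir, false) :: v) 0%R).
- rewrite mulg1 kernel_eval_cat uy mul1g uw add0r /= (negbTE (lt0n_neq0 i0)) vy.
  by rewrite mulg1.
- by rewrite pres_class_cat pres_class_cons uE vE val_braid_y // zpowN mulgA.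
by rewrite winding_cat /= (negbTE (lt0n_neq0 i0)) uw vw add0r subrr mul0r.
Qed.
End UniversalProperty.

Lemma val_kernel_eval k u : val (kernel_eval braid_y k u) =
  zpow a k * pres_class (@artin_B_rel r) u * zpow a (- (k + winding u))%R.
Proof.
elim: u k => [|[i b] u IHu] k; rewrite [kernel_eval _ _ _]/= [winding _]/=.
  by rewrite gmulf1 addr0 zpowN [pres_class _ _](_ : _ = 1) // mulg1 mulgV.
rewrite pres_class_cons; case: ifP => [/eqP i0|i0].
  rewrite IHu i0 addrA; congr (_ * _); rewrite mulgA; congr (_ * _).
  by case: b; rewrite zpowD ?zpowN zpow1.
rewrite val_kernelM IHu add0r !mulgA; congr (_ * _ * _).
have i_gt0 : 0 < i by rewrite lt0n i0.
case: b; rewrite ?val_kernelV val_braid_y // ?invgM ?invgK.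
  by rewrite !mulgA mulgVK.
by rewrite mulgVK.
Qed.

(** This says that [braid_al] and the [braid_y k i] generate K. With [morph_kernel_lift], it shows
    that a lift of the generators to an extension of K that respects the relations induces a
    section. *)
Lemma kernel_lift_id g : kernel_lift braid_al braid_y g = g.
Proof.
have gE : pres_class _ (repr (val g)) = val g by rewrite /pres_class reprK.
have [q gq] := kernel_winding gE.
rewrite (kernel_liftE kernel_braid_rels gE gq); apply: val_inj.
rewrite val_kernelM val_kernel_eval gE gq add0r mul1g.
by rewrite (morph_zpow val_kernelM) val_braid_al -zpow_zpow zpowN mulgVK.
Qed.

Lemma morph_kernel_lift (H H' : groupType) (f : H -> H') al y g :
  {morph f : x y / x * y} ->
  f (kernel_lift al y g) = kernel_lift (f al) (fun k i => f (y k i)) g.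
Proof. by move=> fM; rewrite fM kernel_eval_morph // (morph_zpow fM). Qed.

End Evaluation.

(** * Bar chains and central extensions *)

(** No normalisation is imposed, since the class of [1|1] is not zero in Q: its boundary is [1].
    This is why [c 1 1] enters the unit, the inverse and the embedding of [M] below. *)
Record cocycle (K : groupType) (M : zmodType) := Cocycle {
  cocycle_fun :> K -> K -> M;
  cocycleP x y z : (cocycle_fun x y + cocycle_fun (x * y) z =
                    cocycle_fun y z + cocycle_fun x (y * z))%R }.

Definition cext (K : groupType) (M : zmodType) of cocycle K M : Type :=
  (K * M)%type.

Section CentralExtension.
Variables (K : groupType) (M : zmodType) (c : cocycle K M).

Lemma cocycle1g x : c 1 x = c 1 1.
Proof. by have := cocycleP c 1 1 x; rewrite !mul1g => /addIr. Qed.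

Lemma cocycleg1 x : c x 1 = c 1 1.
Proof. by have := cocycleP c x 1 1; rewrite !mulg1 => /addIr. Qed.

Lemma cocyclegV x : c x x^-1 = c x^-1 x.
Proof.
have := cocycleP c x x^-1 x.
by rewrite mulgV mulVg cocycle1g cocycleg1 => /addIr.
Qed.

Local Notation E := (cext c).

HB.instance Definition _ := Choice.copy E (K * M)%type.

Definition cext_mul (x y : E) : E :=
  (x.1 * y.1, (x.2 + y.2 + c x.1 y.1)%R).
Definition cext_one : E := (1, (- c 1%g 1%g)%R).
Definition cext_inv (x : E) : E :=
  (x.1^-1, (- x.2 - c (x.1^-1)%g x.1 - c 1%g 1%g)%R).

Lemma cext_mulA : associative cext_mul.
Proof.
move=> [x m] [y n] [z p]; congr pair; rewrite /= ?mulgA //.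
have := cocycleP c x y z => E.
have -> : (m + n + c x y + p + c (x * y)%g z =
  m + n + p + (c x y + c (x * y)%g z))%R.
  by rewrite !addrA; congr (_ + _)%R; rewrite addrAC.
by rewrite E !addrA.
Qed.

Lemma cext_mul1 : left_id cext_one cext_mul.
Proof.
by move=> [x m]; rewrite /cext_mul /= mul1g cocycle1g addrAC addNr add0r.
Qed.

Lemma cext_mulr1 : right_id cext_one cext_mul.
Proof. by move=> [x m]; rewrite /cext_mul /= mulg1 cocycleg1 addrNK. Qed.

Lemma cext_mulV : left_inverse cext_one cext_inv cext_mul.
Proof.
move=> [x m]; rewrite /cext_mul /cext_one /= mulVg; congr pair.
by rewrite [X in (X + _)%R]addrC !addrA addrN add0r addrAC addNr add0r.
Qed.

Lemma cext_mulrV : right_inverse cext_one cext_inv cext_mul.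
Proof.
move=> [x m]; rewrite /cext_mul /cext_one /= mulgV cocyclegV; congr pair.
by rewrite !addrA addrN add0r addrAC addNr add0r.
Qed.

HB.instance Definition _ :=
  isGroup.Build E cext_mulA cext_mul1 cext_mulr1 cext_mulV cext_mulrV.

Definition cext_pi (x : E) : K := x.1.
Definition cext_sec (g : K) : E := (g, 0%R).
Definition cext_in (m : M) : E := (1, (m - c 1%g 1%g)%R).

Lemma cext_piM : {morph cext_pi : x y / x * y}.
Proof. by []. Qed.

Lemma cext_secK : cancel cext_sec cext_pi.
Proof. by []. Qed.

Lemma cext_inD m n : cext_in (m + n)%R = cext_in m * cext_in n.
Proof.
congr pair; rewrite /= ?mulg1 //.
by rewrite -[RHS]addrA addrNK addrAC.
Qed.

Lemma cext_in0 : cext_in 0%R = 1.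
Proof. by rewrite /cext_in sub0r. Qed.

Lemma cext_in_inj : injective cext_in.
Proof. by move=> m n [] /addIr. Qed.

Lemma cext_central x y : cext_pi x = 1 -> commute x y.
Proof.
case: x y => [x m] [y n]; rewrite /cext_pi /= => ->.
congr pair; rewrite /= ?mul1g ?mulg1 //.
by rewrite cocycle1g cocycleg1 [(m + n)%R]addrC.
Qed.

Lemma cext_piP x : cext_pi x = 1 -> exists m, x = cext_in m.
Proof.
case: x => [x m]; rewrite /cext_pi /= => ->; exists (m + c 1%g 1%g)%R.
by rewrite /cext_in addrK.
Qed.
End CentralExtension.

Section ExtensionMap.
Variables (K H : groupType) (M A : zmodType).
Variables (c : cocycle K M) (d : cocycle H A) (F : K -> H) (f : {additive M ->
  A}).
Hypothesis FM : {morph F : x y / x * y}.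
Hypothesis fc : forall x y, f (c x y) = d (F x) (F y).

Definition cext_map (x : cext c) : cext d := (F x.1, f x.2).

Lemma cext_mapM : {morph cext_map : x y / x * y}.
Proof. by move=> x y; congr pair; rewrite /= ?FM // !raddfD fc. Qed.

Lemma cext_map_in m : cext_map (cext_in c m) = cext_in d (f m).
Proof. by congr pair;
  rewrite /= ?(morph_one FM) // raddfB fc (morph_one FM). Qed.

Lemma cext_map_sec g : cext_map (cext_sec c g) = cext_sec d (F g).
Proof. by congr pair; rewrite /= raddf0. Qed.
End ExtensionMap.

Section Pushforward.
Variables (K : groupType) (M A : zmodType) (c : cocycle K M) (f :
  {additive M -> A}).

Lemma cocycle_push_subproof x y z :
  (f (c x y) + f (c (x * y)%g z) = f (c y z) + f (c x (y * z)%g))%R.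
Proof. by rewrite -!raddfD cocycleP. Qed.

Definition cocycle_push := Cocycle cocycle_push_subproof.
End Pushforward.

Section Pullback.
Variables (K H : groupType) (A : zmodType) (d : cocycle H A) (F : K -> H).
Hypothesis FM : {morph F : x y / x * y}.

Lemma cocycle_pull_subproof x y z :
  (d (F x) (F y) + d (F (x * y)%g) (F z) =
    d (F y) (F z) + d (F x) (F (y * z)%g))%R.
Proof. by rewrite !FM cocycleP. Qed.

Definition cocycle_pull := Cocycle cocycle_pull_subproof.
End Pullback.

(** * The cokernel Q of the bar differential, and its tautological cocycle *)

Section Bar2.
Variable K : groupType.

Local Notation C := (bar_chain K).
Local Notation bar1 g := (Freeg [:: (1%R : int, [tuple g : K])] : C 1).
Local Notation bar2 g h := (Freeg [:: (1%R : int, [tuple g : K; h])] : C 2).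

Lemma bar_face_eq n i (t : n.+1.-tuple K) (s : n.-tuple K) :
  (forall k, k < n -> nth 1 s k =
    if k.+1 < i then nth 1 t k
    else if k.+1 == i then nth 1 t k * nth 1 t k.+1 else nth 1 t k.+1) ->
  bar_face i t = s.
Proof.
move=> E; apply: val_inj; apply: (@eq_from_nth _ 1);
  rewrite !size_tuple // => k kn.
by rewrite E // nth_bar_face.
Qed.

Lemma bar_d2 g h : bar_d (bar2 g h) = (bar1 h - bar1 (g * h)%g + bar1 g)%R.
Proof.
rewrite bar_dU !big_ord_recl big_ord0 addr0 /= !mulr1z.
have -> : bar_face 0 [tuple g; h] = [tuple h].
  by apply: bar_face_eq; case.
have -> : bar_face 1 [tuple g; h] = [tuple g * h].
  by apply: bar_face_eq; case.
have -> : bar_face 2 [tuple g; h] = [tuple g].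
  by apply: bar_face_eq; case.
by rewrite expr0 expr1 -signr_odd /= expr0 -freegUN addrA.
Qed.

Lemma bar_d3 x y z : bar_d (Freeg [:: (1%R : int, [tuple x; y; z])] : C 3) =
  (bar2 y z - bar2 (x * y)%g z + bar2 x (y * z)%g - bar2 x y)%R.
Proof.
rewrite bar_dU !big_ord_recl big_ord0 addr0 /= !mulr1z.
have -> : bar_face 0 [tuple x; y; z] = [tuple y; z].
  by apply: bar_face_eq; do 2?case=> //.
have -> : bar_face 1 [tuple x; y; z] = [tuple x * y; z].
  by apply: bar_face_eq; do 2?case=> //.
have -> : bar_face 2 [tuple x; y; z] = [tuple x; y * z].
  by apply: bar_face_eq; do 2?case=> //.
have -> : bar_face 3 [tuple x; y; z] = [tuple x; y].
  by apply: bar_face_eq; do 2?case=> //.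
rewrite expr0 expr1 -signr_odd /= expr0 -(signr_odd _ 3) /= expr1.
by rewrite -!freegUN !addrA.
Qed.

(** Unlike [bar_boundary], this is a subgroup of all 2-chains and not only of the cycles, so that
    the quotient contains the classes of all symbols [g|h]. *)
Definition bar_boundary2 : {pred C 2} :=
  fun z => `[< exists w : C 3, z = bar_d w >].

Lemma bar_boundary2_zmod_closed : zmod_closed bar_boundary2.
Proof.
split; first by apply/asboolP; exists 0%R; rewrite raddf0.
move=> x y /asboolP[w ->] /asboolP[w' ->]; apply/asboolP; exists (w - w')%R.
by rewrite raddfB.
Qed.

HB.instance Definition _ :=
  GRing.isZmodClosed.Build (C 2) bar_boundary2 bar_boundary2_zmod_closed.

Definition bar_coker := Quotient.quot bar_boundary2.
HB.instance Definition _ := GRing.Zmodule.on bar_coker.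

Local Notation Q := bar_coker.
Definition bar_proj (z : C 2) : Q := (\pi_(Quotient.quot bar_boundary2) z)%qT.

Lemma bar_projB : zmod_morphism bar_proj.
Proof. exact: pi_is_zmod_morphism. Qed.

HB.instance Definition _ :=
  GRing.isZmodMorphism.Build (C 2) Q bar_proj bar_projB.

Lemma bar_proj_surj q : exists z, q = bar_proj z.
Proof. by exists (repr q); rewrite /bar_proj reprK. Qed.

Lemma bar_projP z : bar_proj z = 0%R <-> exists w : C 3, z = bar_d w.
Proof.
rewrite -(raddf0 bar_proj); split.
  move/eqP; rewrite /bar_proj -Quotient.idealrBE subr0; exact: asboolP.
move=> zw; apply/eqP; rewrite /bar_proj -Quotient.idealrBE subr0; exact/asboolP.
Qed.

Definition univ_cocycle_fun x y := bar_proj (bar2 x y).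

(** The identity expresses that the boundary of [x|y|z] vanishes in Q. *)
Lemma univ_cocycle_subproof x y z :
  (univ_cocycle_fun x y + univ_cocycle_fun (x * y)%g z =
   univ_cocycle_fun y z + univ_cocycle_fun x (y * z)%g)%R.
Proof.
have /eqP := proj2 (bar_projP _) (ex_intro _ _ (erefl (bar_d
  (Freeg [:: (1%R : int, [tuple x; y; z])] : C 3)))).
rewrite bar_d3 raddfB raddfD raddfB subr_eq0 /= -!/(univ_cocycle_fun _ _) =>
  /eqP <-.
by rewrite addrAC addrNK.
Qed.

Definition univ_cocycle := Cocycle univ_cocycle_subproof.

Local Notation tau := univ_cocycle.

Lemma bar_chain_ind n (V : zmodType) (f g : {additive C n -> V}) :
  (forall t, f (Freeg [:: (1%R : int, t)]) = g (Freeg [:: (1%R : int, t)])) ->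
  f =1 g.
Proof.
move=> fg z; rewrite -[z]freeg_sumE !raddf_sum /=; apply: eq_bigr => t _.
by rewrite -[coeff t z in LHS]intz -[coeff t z in RHS]intz -freegU_mulz
  !raddfMz fg.
Qed.

Lemma tuple2E (t : 2.-tuple K) : t = [tuple tnth t 0%R; tnth t 1%R].
Proof. by case/tupleP: t => x t; case/tupleP: t => y t; apply: val_inj;
  rewrite /= [t]tuple0. Qed.

Lemma bar_coker_ind (V : zmodType) (f g : {additive Q -> V}) :
  (forall x y, f (tau x y) = g (tau x y)) -> f =1 g.
Proof.
move=> fg q; have [z ->] := bar_proj_surj q.
apply: (@bar_chain_ind _ _ (f \o bar_proj) (g \o bar_proj)) => t.
by rewrite [t]tuple2E; apply: fg.
Qed.

Lemma bar_coker_induced (V : zmodType) (f : {additive C 2 -> V}) :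
  (forall w, f (bar_d w) = 0%R) ->
  exists phi : {additive Q -> V}, forall z, phi (bar_proj z) = f z.
Proof.
move=> f0.
have fE z z' : bar_proj z = bar_proj z' -> f z = f z'.
  move/eqP; rewrite -subr_eq0 -raddfB => /eqP/bar_projP[w zz'].
  by apply/eqP; rewrite -subr_eq0 -raddfB zz' f0.
pose phi (q : Q) := f (repr q).
have phiE z : phi (bar_proj z) = f z by apply: fE; rewrite /bar_proj reprK.
have phiB : zmod_morphism phi.
  move=> p q; have [z ->] := bar_proj_surj p; have [z' ->] := bar_proj_surj q.
  by rewrite -raddfB !phiE raddfB.
pose phi_ := GRing.isZmodMorphism.Build _ _ phi phiB.
by exists (HB.pack_for {additive Q -> V} phi phi_) => z; apply: phiE.
Qed.

(** Extended linearly to 2-chains, [d] kills the boundaries by the cocycle identity, hence factors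
    through Q. *)
Lemma univ_cocycleP (A : zmodType) (d : cocycle K A) :
  exists phi : {additive Q -> A}, forall x y, phi (tau x y) = d x y.
Proof.
pose F (t : 2.-tuple K) : zmodule A := d (tnth t 0%R) (tnth t 1%R).
have liftB : zmod_morphism (fglift F : C 2 -> A) := lift_is_additive F.
pose f := HB.pack_for {additive C 2 -> A} (fglift F : C 2 -> A)
  (GRing.isZmodMorphism.Build _ _ (fglift F : C 2 -> A) liftB).
have fE x y : f (bar2 x y) = d x y by rewrite [LHS]liftU scale1r.
have [|phi phiE] := bar_coker_induced (f := f); last by exists phi => x y;
  rewrite phiE fE.
move=> w; have := @bar_chain_ind 3 A (f \o @bar_d K 2) (\0)%R; apply;
  move: w => _ t.
have [x [y [z ->]]] : exists x y z, t = [tuple x; y; z].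
  case/tupleP: t => x t; case/tupleP: t => y t; case/tupleP: t => z t.
  by exists x, y, z; apply: val_inj; rewrite /= [t]tuple0.
change (f (bar_d (Freeg [:: (1%R : int, [tuple x; y; z])] : C 3)) = 0%R).
rewrite bar_d3 raddfB raddfD raddfB !fE addrAC; apply/eqP.
by rewrite addrAC subr_eq0 addrAC subr_eq -cocycleP addrC.
Qed.

Lemma bar_coker_bdP : exists bd : {additive Q -> C 1},
  forall z, bd (bar_proj z) = bar_d z.
Proof. by apply: bar_coker_induced => w; apply: bar_d_bar_d. Qed.

Definition bar_coker_bd : {additive Q -> C 1} := sval (cid bar_coker_bdP).

Lemma bar_coker_bdE z : bar_coker_bd (bar_proj z) = bar_d z.
Proof. by rewrite /bar_coker_bd; case: cid. Qed.

(* The boundary map extended to a morphism on the universal extension: a product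
   of conjugates whose exponents cancel is killed, so that it gives a cycle. *)
Definition univ_theta (x : cext tau) : C 1 := (bar1 x.1 + bar_coker_bd x.2)%R.

Lemma univ_thetaM x y : univ_theta (x * y) = (univ_theta x + univ_theta y)%R.
Proof.
rewrite /univ_theta /= !raddfD /= [bar_coker_bd (bar_proj _)]bar_coker_bdE
  bar_d2.
have shuffle (V : zmodType) (a b c p q : V) :
    (c + (p + q + (b - c + a)) = a + p + (b + q))%R.
  rewrite addrCA; have -> : (c + (b - c + a) = a + b)%R.
    by rewrite [(b - c + a)%R]addrAC [LHS]addrC subrK addrC.
  by rewrite addrC addrACA.
exact: shuffle.
Qed.

Lemma univ_theta_in q : univ_theta (cext_in tau q) = bar_coker_bd q.
Proof.
rewrite /univ_theta /= raddfB /= [bar_coker_bd (bar_proj _)]bar_coker_bdE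
  bar_d2.
by rewrite mulg1 subrr add0r addrC subrK.
Qed.

Lemma univ_theta1 : univ_theta 1 = 0%R.
Proof. by apply: (addIr (univ_theta 1)); rewrite -univ_thetaM mulg1 add0r. Qed.

Lemma univ_thetaV x : univ_theta x^-1 = (- univ_theta x)%R.
Proof. by apply: (addIr (univ_theta x));
  rewrite -univ_thetaM mulVg univ_theta1 addNr. Qed.

Lemma univ_thetaJ x y : univ_theta (x ^ y) = univ_theta x.
Proof. by rewrite conjgE !univ_thetaM univ_thetaV addrCA addNr addr0. Qed.

(** The second component [h] of the section [F] satisfies [h (x * y) = h x + h y + psi (tau x y)],
    so [psi] is minus the composite of the boundary with the linear extension of [h]. Thus [psi]
    vanishes on cycles, where [q = j (phi q)]: [phi] is injective there, and [j] provides
    preimages. *)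
Lemma H2_iso (A : zmodType) (phi : {additive Q -> A}) (j : {additive A -> Q})
    (psi : {additive Q -> Q}) (F : K -> cext (cocycle_push tau psi)) :
  (forall a, bar_coker_bd (j a) = 0%R) -> cancel j phi ->
  (forall q, psi q = (q - j (phi q))%R) ->
  {morph F : x y / x * y} -> (forall g, (F g).1 = g) ->
  zmod_iso (group_homology K 2) A.
Proof.
move=> bdj jK psiE FM F1.
have psi0 q : bar_coker_bd q = 0%R -> psi q = 0%R.
  pose h (g : K) := (F g).2.
  pose h1 : {additive C 1 -> Q} := HB.pack_for {additive C 1 -> Q}
    (fglift (fun t : 1.-tuple K => h (tnth t 0%R) : zmodule Q) : C 1 -> Q)
    (GRing.isZmodMorphism.Build _ _ (_ : C 1 -> Q)
      (lift_is_additive (fun t : 1.-tuple K => h (tnth t 0%R) : zmodule Q))).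
  have h1E x : h1 (bar1 x) = h x by rewrite [LHS]liftU scale1r.
  have psiD : (psi \+ (h1 \o bar_coker_bd))%R =1 (\0 : Q -> Q)%R.
    move=> p; apply: (@bar_coker_ind _ (psi \+ (h1 \o bar_coker_bd))%R (\0)%R)
      => x y.
    change (psi (tau x y) + h1 (bar_coker_bd (bar_proj (bar2 x y))) = 0)%R.
    rewrite bar_coker_bdE bar_d2 raddfD raddfB !h1E.
    have := congr1 snd (FM x y); rewrite /= !F1 -/(h _) -/(h _) -/(h _) => ->.
    have shuffle (V : zmodType) (a b m : V) : (m + (b - (a + b + m) + a) = 0)%R.
      rewrite (_ : b - (a + b + m) + a = - m)%R ?subrr //.
      by rewrite addrAC (addrC b) opprD addrA subrr add0r.
    exact: shuffle.
  by move=> q0; have : (psi q + h1 (bar_coker_bd q) = 0)%R := psiD q;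
    rewrite q0 raddf0 addr0.
pose cls (z : bar_cycles K 2) : group_homology K 2 :=
  (\pi_(Quotient.quot (@bar_boundary K 2)) z)%qT.
have clsB : {morph cls : x y / (x - y)%R} by exact: pi_is_zmod_morphism.
(* This identifies H_2 with the kernel of [bar_coker_bd]: classes of cycles may be compared in Q. *)
have cls_eq z z' : cls z = cls z' <-> bar_proj (val z) = bar_proj (val z').
  have zB : (bar_proj (val z - val z') = 0 <-> bar_proj (val z) =
    bar_proj (val z'))%R.
    rewrite raddfB; split=> [/eqP|E]; first by rewrite subr_eq0 => /eqP.
    by apply/eqP; rewrite subr_eq0; apply/eqP.
  rewrite -zB bar_projP; split.
    move/eqP; rewrite /cls -Quotient.idealrBE => /asboolP[w wE].
    by exists w; rewrite -wE.
  move=> [w wE]; apply/eqP; rewrite /cls -Quotient.idealrBE; apply/asboolP.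
  by exists w; rewrite -wE.
have cls_surj x : exists z, x = cls z by exists (repr x); rewrite /cls reprK.
pose f (x : group_homology K 2) : A := phi (bar_proj (val (repr x))).
have fE z : f (cls z) = phi (bar_proj (val z)).
  by congr (phi _); apply/cls_eq; rewrite /cls reprK.
have fB : zmod_morphism f.
  move=> x y; have [z ->] := cls_surj x; have [z' ->] := cls_surj y.
  by rewrite -clsB !fE -!raddfB.
have bd_cycle (z : bar_cycles K 2) : bar_coker_bd (bar_proj (val z)) = 0%R.
  by rewrite bar_coker_bdE; apply/eqP; apply: (valP z).
have f_inj : injective f.
  move=> x y; have [z ->] := cls_surj x; have [z' ->] := cls_surj y.
  rewrite !fE => zz'; apply/cls_eq; apply/eqP; rewrite -subr_eq0 -raddfB.
  have := psi0 (bar_proj (val z - val z')%R).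
  rewrite psiE !raddfB !bd_cycle => /(_ (subr0 _)).
  by rewrite /= zz' subrr addr0 => ->.
have f_surj a : exists x, f x = a.
  have [z zE] := bar_proj_surj (j a).
  have z_cycle : z \in @bar_cycle K 2.
    by apply/eqP; rewrite -bar_coker_bdE -zE bdj.
  by exists (cls (Sub z z_cycle)); rewrite fE /= -zE jK.
have [g gK] := choice f_surj.
exists (HB.pack_for {additive group_homology K 2 -> A} f
  (GRing.isZmodMorphism.Build _ _ f fB)).
by exists g => // x; apply: f_inj; rewrite gK.
Qed.

End Bar2.

Arguments bar_coker_bd {K}.

(** * Functionals defined by projective morphisms *)

Record central_emb (A : zmodType) (G : groupType) := CentralEmb {
  central_fun :> A -> G;
  central_funD a b : central_fun (a + b)%R = central_fun a * central_fun b;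
  central_funC a x : commute (central_fun a) x;
  central_fun_inj : injective central_fun }.

Section CentralQuotient.
Variables (A : zmodType) (G : groupType) (iota : central_emb A G).

Lemma central_fun0 : iota 0%R = 1.
Proof. by apply: (@mulgI _ (iota 0%R)); rewrite -central_funD addr0 mulg1. Qed.

Lemma central_funN a : iota (- a)%R = (iota a)^-1.
Proof. by apply: (@mulgI _ (iota a));
  rewrite -central_funD subrr central_fun0 mulgV. Qed.

Lemma central_mulM a b x y :
  x * iota a * (y * iota b) = x * y * iota (a + b)%R.
Proof.
rewrite central_funD -!mulgA; congr (_ * _).
by rewrite !mulgA (central_funC iota a y).
Qed.

Definition central_eqb (x y : G) : bool := `[< exists a, y = x * iota a >].

Lemma central_eqb_equiv : equiv_class_of central_eqb.
Proof.
split=> [x | x y | y x z].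
- by apply/asboolP; exists 0%R; rewrite central_fun0 mulg1.
- by apply/asboolP/asboolP => -[a ->]; exists (- a)%R;
    rewrite central_funN mulgK.
- move=> /asboolP[a ->] /asboolP[b ->]; apply/asboolP; exists (a + b)%R.
  by rewrite central_funD mulgA.
Qed.

Canonical central_equivRel := EquivRelPack central_eqb_equiv.
Canonical central_encModRel := defaultEncModRel central_eqb.

Definition cquot := {eq_quot central_eqb}%qT.

HB.instance Definition _ : EqQuotient G central_eqb cquot :=
  EqQuotient.on cquot.
HB.instance Definition _ := Choice.on cquot.

Definition cquot_class (x : G) : cquot := (\pi_cquot x)%qT.

Lemma cquot_classP x y :
  cquot_class x = cquot_class y <-> exists a, y = x * iota a.
Proof.
split=> [/eqP|xy]; first by rewrite /cquot_class piE => /asboolP.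
by apply/eqP; rewrite /cquot_class piE; apply/asboolP.
Qed.

Lemma cquot_class_repr (x : cquot) : cquot_class (repr x) = x.
Proof. by rewrite /cquot_class reprK. Qed.

Definition cquot_mul (x y : cquot) : cquot := cquot_class (repr x * repr y).
Definition cquot_one : cquot := cquot_class 1.
Definition cquot_inv (x : cquot) : cquot := cquot_class (repr x)^-1.

Lemma cquot_mulE x y :
  cquot_mul (cquot_class x) (cquot_class y) = cquot_class (x * y).
Proof.
have [a xE] := (cquot_classP x (repr (cquot_class x))).1 (esym
  (cquot_class_repr _)).
have [b yE] := (cquot_classP y (repr (cquot_class y))).1 (esym
  (cquot_class_repr _)).
apply/esym/cquot_classP; exists (a + b)%R.
by rewrite xE yE central_mulM.
Qed.

Lemma cquot_mulA : associative cquot_mul.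
Proof.
move=> x y z; rewrite -[x]cquot_class_repr -[y]cquot_class_repr
  -[z]cquot_class_repr.
by rewrite !cquot_mulE mulgA.
Qed.

Lemma cquot_mul1 : left_id cquot_one cquot_mul.
Proof. by move=> x; rewrite -[x]cquot_class_repr cquot_mulE mul1g. Qed.

Lemma cquot_mulr1 : right_id cquot_one cquot_mul.
Proof. by move=> x; rewrite -[x]cquot_class_repr cquot_mulE mulg1. Qed.

Lemma cquot_mulV : left_inverse cquot_one cquot_inv cquot_mul.
Proof. by move=> x; rewrite -{2}[x]cquot_class_repr cquot_mulE mulVg. Qed.

Lemma cquot_mulrV : right_inverse cquot_one cquot_inv cquot_mul.
Proof. by move=> x; rewrite -{1}[x]cquot_class_repr cquot_mulE mulgV. Qed.

HB.instance Definition _ :=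
  isGroup.Build cquot cquot_mulA cquot_mul1 cquot_mulr1 cquot_mulV cquot_mulrV.

Lemma cquot_classM : {morph cquot_class : x y / x * y}.
Proof. by move=> x y; rewrite [RHS]cquot_mulE. Qed.

Lemma cquot_cocycle_ex (x y : cquot) :
  exists a, repr x * repr y = repr (x * y) * iota a.
Proof. by apply/cquot_classP; rewrite cquot_class_repr. Qed.

(** The factor set of [G], seen as a central extension of [cquot] by [A], for the section [repr];
    [cquot_cext] maps the extension that it defines back to [G]. *)
Definition cquot_cocycle_fun (x y : cquot) : A :=
  sval (cid (cquot_cocycle_ex x y)).

Lemma cquot_cocycleE (x y : cquot) :
  repr x * repr y = repr (x * y) * iota (cquot_cocycle_fun x y).
Proof. by rewrite /cquot_cocycle_fun; case: cid. Qed.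

Lemma cquot_cocycle_subproof (x y z : cquot) :
  (cquot_cocycle_fun x y + cquot_cocycle_fun (x * y)%g z =
   cquot_cocycle_fun y z + cquot_cocycle_fun x (y * z)%g)%R.
Proof.
apply: (@central_fun_inj _ _ iota); apply: (@mulgI _ (repr (x * y * z))).
transitivity (repr x * repr y * repr z).
  rewrite addrC central_funD mulgA -cquot_cocycleE -mulgA.
  by rewrite -central_funC mulgA -cquot_cocycleE.
rewrite -mulgA [repr y * repr z]cquot_cocycleE mulgA cquot_cocycleE.
by rewrite -(mulgA (repr _)) -central_funD addrC mulgA.
Qed.

Definition cquot_cocycle := Cocycle cquot_cocycle_subproof.

Definition cquot_cext (x : cext cquot_cocycle) : G := repr x.1 * iota x.2.

Lemma cquot_cextM : {morph cquot_cext : x y / x * y}.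
Proof.
move=> x y; rewrite /cquot_cext central_mulM cquot_cocycleE -mulgA
  -central_funD.
by rewrite addrC.
Qed.

Lemma cquot_cext_in a : cquot_cext (cext_in _ a) = iota a.
Proof.
rewrite /cquot_cext /=.
have /mulgI -> : repr (1 : cquot) * repr (1 : cquot) =
    repr (1 : cquot) * iota (cquot_cocycle_fun 1 1).
  by rewrite {1}cquot_cocycleE mulg1.
by rewrite -central_funD addrC subrK.
Qed.
End CentralQuotient.

(* A projective morphism to G, that is, a morphism to G modulo the image of
   iota, defines a functional on the cokernel Q of the bar differential; it is
   computed by evaluating central elements of the universal extension in G. *)
Lemma bar_functional e r (r_gt1 : 1 < r) (e_gt0 : 0 < e)
    (A : zmodType) (G : groupType) (iota : central_emb A G) al y :
  kernel_rels e r (cquot_class iota al) (fun k i => cquot_class iota (y k i)) ->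
  let K := complex_braid_group e r in
  exists (phi : {additive bar_coker K -> A})
         (Phi : cext (univ_cocycle K) -> G),
    [/\ {morph Phi : x y / x * y},
        forall q, Phi (cext_in _ q) = iota (phi q),
        exists a, Phi (cext_sec _ (braid_al e r)) = al * iota a &
        forall k i, 0 < i < r ->
          exists a, Phi (cext_sec _ (braid_y e r k i)) = y k i * iota a].
Proof.
move=> yP K.
pose F := kernel_lift (cquot_class iota al) (fun k i => cquot_class iota (y k
  i)) : K -> _.
have FM : {morph F : x y / x * y} := kernel_liftM r_gt1 e_gt0 yP.
have [phi phiE] := univ_cocycleP (cocycle_pull (cquot_cocycle iota) FM).
pose Phi x := cquot_cext (cext_map (cquot_cocycle iota) F phi (x :
  cext (univ_cocycle K))).
(* Since [repr] picks an unspecified representative, values at generators are known only up to the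
   image of [iota]. *)
have secE g x : F g = cquot_class iota x ->
  exists a, Phi (cext_sec _ g) = x * iota a.
  move=> gx; rewrite /Phi cext_map_sec /cquot_cext /= central_fun0 mulg1 gx.
  by apply/cquot_classP; rewrite cquot_class_repr.
exists phi, Phi; split.
- by move=> x x'; rewrite /Phi (cext_mapM FM) ?cquot_cextM.
- by move=> q; rewrite /Phi (cext_map_in FM) ?cquot_cext_in.
- by apply: secE; apply: kernel_lift_al.
by move=> k i ir; apply: secE; apply: (kernel_lift_y r_gt1 e_gt0 yP).
Qed.

(** * Relations in central extensions of the kernel, rank at least 3 *)

Section Braiding.
Variable H : groupType.
Implicit Types x y z s p q t v c : H.

Definition braided x y := x * y * x = y * x * y.

Lemma braided_sym x y : braided x y -> braided y x.
Proof. exact: esym. Qed.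

Lemma braided_conj x y : braided x y <-> x ^ (y * x) = y.
Proof.
rewrite /braided conjgE; split=> [xy|xy].
  by rewrite [x * (y * x)]mulgA xy mulKg.
by rewrite -{3}xy mulVKg mulgA.
Qed.

Lemma braidedJ x y : braided x y -> x ^ y = y ^ x^-1.
Proof. by move=> /braided_conj; rewrite conjgM => /(canRL (conjgK x)). Qed.

(** Here [x], [z], [y] behave as the standard generators of the braid group on four strands, in this
    order, and z x y z exchanges the two outer ones. *)
Lemma braided_swap x z y : braided x z -> braided y z -> commute x y ->
  x ^ (z * x * (y * z)) = y /\ y ^ (z * x * (y * z)) = x.
Proof.
move=> xz yz xy; split.
  by rewrite conjgM ((braided_conj x z).1 xz) ((braided_conj z y).1 (esym yz)).
rewrite !conjgM (braidedJ yz).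
have -> : (z ^ y^-1) ^ x = (z ^ x) ^ y^-1.
  by rewrite -!conjgM (commuteV xy).
by rewrite conjgKV (braidedJ (esym xz)) conjgKV.
Qed.

Lemma central_conj c x : (forall y, commute c y) -> c ^ x = c.
Proof. by move=> cC; rewrite conjgE cC mulKg. Qed.

(* The defect of the braid relation is invariant under conjugation. Conjugating
   it three times, by t, s and q, carries the defect of the pair (q^t, s) to
   that of the pair (s, p). *)
Lemma braided_defect s p q t v b b' :
  (forall x, commute b x) -> (forall x, commute b' x) ->
  braided p s -> braided q s -> braided t s -> braided v s ->
  q * t = p * q * b -> t * v = q * t * b' -> b = b'.
Proof.
move=> bC b'C ps qs ts vs qt tv.
pose defect x y := x * y * x * b' = y * x * y.
have defectJ x y z : defect x y -> defect (x ^ z) (y ^ z).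
  by rewrite /defect -{2}(central_conj z b'C) -!conjMg => ->.
have vE : v = q ^ t * b' by rewrite conjgE -mulgA -tv mulKg.
have tE : t = p ^ q * b by rewrite conjgE -mulgA -qt mulKg.
have pull c : (forall x, commute c x) ->
    (forall x, x * c = c * x) * (forall x y, x * (c * y) = c * (x * y)).
  by move=> cC; split=> [x|x y]; rewrite ?(cC x) // !mulgA (cC x).
have [bl blA] := pull b bC; have [b'l b'lA] := pull b' b'C.
have D1 : defect (q ^ t) s.
  move: vs; rewrite /braided /defect vE; move: (q ^ t) => u.
  rewrite -!mulgA !(b'lA u, b'lA s, b'l u, b'l s).
  by move=> /mulgI.
have D2 : defect q (t ^ s).
  by rewrite (braidedJ ts) -{1}(conjgK t q); apply: defectJ.
have D3 : defect (s ^ q) t.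
  by rewrite (braidedJ (esym qs)) -{1}(conjgK s t); apply: defectJ.
have SP : braided (s ^ q) (p ^ q) by rewrite /braided -!conjMg ps.
(* [t = p ^ q * b] occurs once on the left of [D3] and twice on the right, so that comparison with
   the exact relation [SP] leaves [b' = b]. *)
move: D3 SP; rewrite /defect /braided tE; move: (s ^ q) (p ^ q) => u w.
rewrite -!mulgA !(blA u, blA w, bl u, bl w) => /mulgI E SP.
have : b' * (u * (w * u)) = b * (u * (w * u)).
  by rewrite {2}SP -E !mulgA b'l !mulgA.
by move/mulIg.
Qed.

End Braiding.

Section KernelRelations.
Variables (e r : nat) (H : groupType) (al : H) (g : int -> nat -> H).
Hypothesis gP : kernel_rels e r al g.

Lemma kernel_rel_const k i : 1 < i < r -> g k i = g 0%R i.
Proof.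
move=> ir; elim/int_step_ind: k => // k.
by rewrite (rel_shift gP).
Qed.

Lemma kernel_rel_conj (k : int) i : 0 < i < r -> g (k + e)%R i ^ al = g k i.
Proof. by move=> ir; rewrite conjgE -(rel_conj gP) // mulKg. Qed.

Lemma kernel_rel_quadJ k :
  g k 1%N ^ (g k 1%N * g (k + 1)%R 1%N) = g (k + 2)%R 1%N.
Proof. by rewrite conjgM [g k _ ^ g k _]conjgE mulKg conjgE -(rel_quad gP)
  mulKg. Qed.
End KernelRelations.

Section Lifts.
Variables (K E : groupType) (pi : E -> K) (s : K -> E).
Hypothesis piM : {morph pi : x y / x * y}.
Hypothesis piC : forall x y, pi x = 1 -> commute x y.
Hypothesis sK : cancel s pi.

Lemma lift_conj x z z' : pi z = pi z' -> x ^ z = x ^ z'.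
Proof.
move=> zz'; have C : commute (z' * z^-1) x.
  by apply: piC; rewrite piM (morph_inv piM) zz' mulgV.
rewrite -[z' in RHS](mulgVK z) conjgM; congr (_ ^ z).
by rewrite conjgE -C mulKg.
Qed.

Lemma lift_commg x x' y y' :
  pi x = pi x' -> pi y = pi y' -> [~ x, y] = [~ x', y'].
Proof.
by move=> xx' yy'; rewrite commgEl (lift_conj x yy') -commgEl commgEr
  (lift_conj _ xx') -commgEr.
Qed.

Definition lift_comm (x y : K) : E := [~ s x, s y].

Lemma lift_comm_central x y z : commute x y -> commute (lift_comm x y) z.
Proof.
by move=> xy; apply: piC; rewrite (morph_comm piM) !sK; apply/eqP/commgP.
Qed.

Lemma lift_commJ x y z : commute x y ->
  lift_comm (x ^ z) (y ^ z) = lift_comm x y.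
Proof.
move=> xy; rewrite -[RHS](central_conj (s z) (fun w => lift_comm_central w xy)).
by rewrite conjRg; apply: lift_commg; rewrite (morph_conj piM) !sK.
Qed.

Lemma lift_commC x y : lift_comm y x = (lift_comm x y)^-1.
Proof. by rewrite invgR. Qed.

(** The commutator of the lifts is invariant under conjugation, and exchanging its entries inverts
    it. *)
Lemma lift_comm_swap x y z : commute x y -> x ^ z = y -> y ^ z = x ->
  lift_comm x y ^+ 2 = 1.
Proof.
move=> xy xz yz; have := lift_commJ z xy; rewrite xz yz lift_commC => xyV.
by rewrite expg2 -{1}xyV mulVg.
Qed.

(** An arbitrary lift [y] is corrected to [x ^ (y * x)]. By [braided_conj] the image does not
    change; as conjugation depends on images only, the corrected lift satisfies the braid relation
    exactly. *)
Lemma lift_braided x y : braided (pi x) (pi y) ->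
  braided x (x ^ (y * x)) /\ pi (x ^ (y * x)) = pi y.
Proof.
move=> /braided_conj xy.
have yE : pi (x ^ (y * x)) = pi y by rewrite (morph_conj piM) piM xy.
by split=> //; apply/braided_conj/lift_conj; rewrite piM yE piM.
Qed.

Variables (e r : nat) (al : K) (g : int -> nat -> K).
Hypothesis gP : kernel_rels e r al g.
Hypothesis r_gt2 : 2 < r.

Local Notation X := (s (g 0%R 2)).

(** Index [n] stands for generator [n + 2], which does not depend on [k] by [rel_shift]. The lift
    [X] is the common anchor of this chain and of all the [lift_y k 1]. *)
Fixpoint lift_chain n : E :=
  if n is m.+1 then lift_chain m ^ (s (g 0%R n.+2) * lift_chain m) else X.

(* The generators of K are lifted so that the braid relations hold exactly. *)
Definition lift_y k i : E :=
  match i with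
  | 0 => 1
  | 1 => X ^ (s (g k 1%N) * X)
  | n.+2 => lift_chain n
  end.

Lemma lift_y_braid12 k :
  braided X (lift_y k 1) /\ pi (lift_y k 1) = g k 1%N.
Proof.
have [] := @lift_braided X (s (g k 1%N)); last by rewrite !sK.
rewrite !sK; apply: braided_sym; rewrite -(kernel_rel_const gP k) //.
exact: (rel_braid gP).
Qed.

Lemma pi_lift_chain n : n.+2 < r -> pi (lift_chain n) = g 0%R n.+2.
Proof.
elim: n => [|n IHn] nr; first exact: sK.
rewrite /= (proj2 (@lift_braided _ _ _)) ?sK // IHn ?(ltnW nr) //.
exact: (rel_braid gP).
Qed.

Lemma lift_chain_braided n : n.+3 < r ->
  braided (lift_chain n) (lift_chain n.+1).
Proof.
move=> nr; apply: (proj1 (@lift_braided _ _ _)).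
by rewrite sK pi_lift_chain ?(ltnW nr) //; apply: (rel_braid gP).
Qed.

Lemma pi_lift_y k i : 0 < i < r -> pi (lift_y k i) = g k i.
Proof.
case: i => [//|[|n]] /andP[_ ir]; first by have [] := lift_y_braid12 k.
by rewrite /= pi_lift_chain // (kernel_rel_const gP).
Qed.

Definition lift_torus : E := lift_comm al (g 0%R 2).

Definition lift_quad k : E :=
  (lift_y k 1 * lift_y (k + 1)%R 1)^-1 * (lift_y (k + 1)%R 1 * lift_y (k + 2)%R
    1).

Lemma pi_lift_quad k : pi (lift_quad k) = 1.
Proof.
have pi1 m : pi (lift_y m 1) = g m 1%N by apply: pi_lift_y; rewrite /= ltnW.
have pi2 m n : pi (lift_y m 1 * lift_y n 1) = g m 1%N * g n 1%N.
  by rewrite piM !pi1.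
by rewrite piM (morph_inv piM) !pi2 (rel_quad gP) mulVg.
Qed.

Lemma lift_quad_central k x : commute (lift_quad k) x.
Proof. exact/piC/pi_lift_quad. Qed.

(** All the [lift_y k 1] braid exactly with [X], so [braided_defect] applies to four consecutive
    ones. *)
Lemma lift_quad_const k : lift_quad (k + 1)%R = lift_quad k.
Proof.
have bX m : braided (lift_y m 1) X by apply/braided_sym/(lift_y_braid12 m).1.
have quadE m : lift_y (m + 1)%R 1 * lift_y (m + 2)%R 1 =
    lift_y m 1 * lift_y (m + 1)%R 1 * lift_quad m by rewrite mulVKg.
apply/esym; apply: braided_defect (lift_quad_central k) (lift_quad_central _)
  (bX k) (bX (k + 1)%R) (bX (k + 2)%R) (bX (k + 3)%R) (quadE k) _.
by move: (quadE (k + 1)%R); rewrite -!addrA.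
Qed.

(** When the torus commutator is trivial, [s al] fixes [X]. The other lifts arise from [X] by
    conjugations, which depend only on images in K, where [rel_conj] holds. *)
Lemma lift_y_conj (k : int) i : lift_torus = 1 -> 0 < i < r ->
  s al * lift_y k i = lift_y (k + e)%R i * s al.
Proof.
move=> T1; have XC : commute X (s al) by apply/commute_sym/commgP/eqP/T1.
suff yJ : 0 < i < r -> lift_y (k + e)%R i ^ s al = lift_y k i.
  by move=> /yJ <-; rewrite conjgE mulVKg.
have XJ : X ^ s al = X by rewrite conjgE XC mulKg.
have gJ (m : int) j : 0 < j < r ->
  g (m + e)%R j ^ al = g m j  by apply: kernel_rel_conj.
case: i => [//|[|n]] /andP[_ ir].
  rewrite /= conjJg XJ; apply: lift_conj.
  by rewrite conjMg XJ [LHS]piM [RHS]piM (morph_conj piM) !sK gJ.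
elim: n ir => [//|n IHn] ir; rewrite /= conjJg IHn ?(ltnW ir) //.
apply: lift_conj; rewrite conjMg IHn ?(ltnW ir) // [LHS]piM [RHS]piM
  (morph_conj piM) !sK.
by rewrite -{1}(kernel_rel_const gP (0 + Posz e)%R) // gJ.
Qed.

Lemma lift_kernel_rels : lift_torus = 1 -> lift_quad 0%R = 1 ->
  (forall k i j, 0 < i -> i.+1 < j -> j < r -> lift_comm (g k i) (g k j) = 1) ->
  kernel_rels e r (s al) lift_y.
Proof.
move=> T1 b1 C1.
have bk k : lift_quad k = 1.
  by elim/int_step_ind: k => // k; rewrite lift_quad_const.
split.
- by move=> k; rewrite -[RHS]mulg1 -(bk k) mulVKg.
- by move=> k [|[|n]].
- move=> k [//|[|n]] _ ir; first by apply/braided_sym;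
    have [] := lift_y_braid12 k.
  exact: lift_chain_braided.
- move=> k i j i0 ij jr; apply/commgP; rewrite -(C1 k i j) //; apply/eqP.
  by apply: lift_commg; rewrite sK pi_lift_y //; lia.
by move=> k i; apply: lift_y_conj.
Qed.
Local Notation cm k i j := (lift_comm (g k i) (g k j)).

Lemma conj_commute (G : groupType) (x z : G) : commute x z -> x ^ z = x.
Proof. by move=> xz; rewrite conjgE xz mulKg. Qed.

(** Conjugation by [g k 1 * g (k + 1) 1] carries [g k 1] to [g (k + 2) 1] and fixes the generator of
    index 3. *)
Lemma lift_comm_shift2 k : 3 < r -> cm (k + 2)%R 1 3 = cm k 1 3.
Proof.
move=> r_gt3; have C m : commute (g m 1%N) (g m 3) by apply: (rel_comm gP).
have c3 m : g m 3 = g k 3 by rewrite !(kernel_rel_const gP _ (i := 3)).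
rewrite -(lift_commJ (g k 1%N * g (k + 1)%R 1%N) (C k)).
rewrite (kernel_rel_quadJ gP) conj_commute ?(c3 (k + 2)%R) //.
by apply: commuteM; apply: commute_sym; [|rewrite -(c3 (k + 1)%R)]; apply: C.
Qed.

Lemma lift_comm_shift_al (k : int) i j :
  0 < i -> i.+1 < j -> j < r -> cm (k + e)%R i j = cm k i j.
Proof.
move=> i0 ij jr; rewrite -(lift_commJ al); last exact: (rel_comm gP).
by rewrite !(kernel_rel_conj gP) //; lia.
Qed.

Lemma lift_comm13_sqr k : 3 < r -> cm k 1 3 ^+ 2 = 1.
Proof.
move=> r_gt3; have C : commute (g k 1%N) (g k 3) by apply: (rel_comm gP).
have [] := @braided_swap _ (g k 1%N) (g k 2) (g k 3).
- exact: (rel_braid gP).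
- by apply: braided_sym; apply: (rel_braid gP).
- exact: C.
exact: lift_comm_swap.
Qed.

(** Conjugation by two adjacent generators moves one index by a step and fixes the other generator
    as long as all indices stay apart. The second index is pushed to [r.-1], then the first to 2,
    where the dependence on [k] disappears; 2 and [r.-1] are not adjacent because [4 < r]. *)
Lemma lift_comm_const k i j : 4 < r -> 0 < i -> i.+1 < j -> j < r ->
  cm k i j = cm 0%R 2 r.-1.
Proof.
move=> r_gt4 i0 ij jr.
have stepj n : i.+1 < n -> n.+1 < r -> cm k i n.+1 = cm k i n.
  move=> i_n nr; have C m : i.+1 < m -> m < r -> commute (g k i) (g k m).
    exact: (rel_comm gP).
  rewrite -[RHS](lift_commJ (g k n.+1 * g k n)); last by apply: C => //; lia.
  have /braided_conj -> : braided (g k n) (g k n.+1).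
    by apply: (rel_braid gP) => //; lia.
  by rewrite conj_commute //; apply: commuteM; apply: C; lia.
have stepi m : 0 < m -> m.+2 < r.-1 -> cm k m.+1 r.-1 = cm k m r.-1.
  move=> m0 mr; have C n : 0 < n -> n.+1 < r.-1 -> commute (g k n) (g k r.-1).
    by move=> n0 nr; apply: (rel_comm gP) => //; lia.
  rewrite -[RHS](lift_commJ (g k m.+1 * g k m)); last by apply: C => //; lia.
  have /braided_conj -> : braided (g k m) (g k m.+1).
    by apply: (rel_braid gP) => //; lia.
  rewrite conj_commute //.
  by apply: commuteM; apply: commute_sym; apply: C; lia.
have -> : cm k i j = cm k i r.-1.
  have [d rE] : exists d, r.-1 = (j + d)%N by exists (r.-1 - j)%N; lia.
  rewrite rE; have : j + d < r by lia.
  elim: d {rE} => [|d IHd] dr; first by rewrite addn0.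
  by rewrite IHd; [rewrite addnS stepj //; lia | lia].
have -> : cm k i r.-1 = cm k 2 r.-1.
  have from2 n : n.+3 < r.-1 -> cm k n.+2 r.-1 = cm k 2 r.-1.
    by elim: n => // n IHn nr; rewrite stepi ?IHn //; lia.
  case: i i0 ij {stepj} => [//|[|i]] _ ij; last by apply: from2; lia.
  by rewrite -(stepi 1%N) //; lia.
by rewrite !(kernel_rel_const gP k) //; lia.
Qed.
End Lifts.

Section LiftMorphism.
Variables (K E E' : groupType) (s : K -> E) (f : E -> E') (g : int -> nat -> K).
Hypothesis fM : {morph f : x y / x * y}.

Lemma lift_comm_morph x y : f (lift_comm s x y) = lift_comm (f \o s) x y.
Proof. exact: morph_comm. Qed.

Lemma lift_y_morph k i : f (lift_y s g k i) = lift_y (f \o s) g k i.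
Proof.
case: i => [|[|i]]; first exact: morph_one.
  by rewrite /= (morph_conj fM) fM.
by rewrite /=; elim: i => //= n IHn; rewrite (morph_conj fM) fM IHn.
Qed.

Lemma lift_quad_morph k : f (lift_quad s g k) = lift_quad (f \o s) g k.
Proof.
by rewrite fM (morph_inv fM) 2!(fM (lift_y _ _ _ _)) !lift_y_morph.
Qed.
End LiftMorphism.

(** * Relations in central extensions of the kernel, rank 2 *)

Section QuadSequence.
Variable H : groupType.
Implicit Types (al x y : H) (k : int).

(* The sequence u with u k * u (k + 1) constant, u 0 = x and u 1 = y. *)
Definition quad_seq x y k : H :=
  (if (k %% 2)%Z == 0%R then x else y) ^ zpow (x * y) (k %/ 2)%Z.

Definition quad_defect (e : nat) al x y k : H :=
  (quad_seq x y (k + Posz e)%R)^-1 * quad_seq x y k ^ al^-1.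

Lemma quad_seq0 x y : quad_seq x y 0%R = x.
Proof. by rewrite /quad_seq /= conjg1. Qed.

Lemma quad_seq1 x y : quad_seq x y 1%R = y.
Proof. by rewrite /quad_seq /= conjg1. Qed.

Lemma quad_seqM2 x y k (m : nat) :
  quad_seq x y (k + Posz (m * 2)%N)%R = quad_seq x y k ^ ((x * y) ^+ m).
Proof.
rewrite /quad_seq -[(x * y) ^+ m]/(zpow (x * y) m) -conjgM -zpowD.
by rewrite PoszM addrC modzMDl divzMDl // addrC.
Qed.

Lemma quad_seqS2 x y k : quad_seq x y (k + 2)%R = quad_seq x y k ^ (x * y).
Proof. exact: (quad_seqM2 x y k 1). Qed.

Lemma quad_seq_mul x y k : quad_seq x y k * quad_seq x y (k + 1)%R = x * y.
Proof.
elim/int_step_ind: k => [|k]; first by rewrite add0r quad_seq0 quad_seq1.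
rewrite -addrA -[(1 + 1)%R]/(2%:R : int)%R quad_seqS2.
move: (quad_seq x y k) (quad_seq x y (k + 1)%R) (x * y) => u v w; split=> E.
  by rewrite -E conjgM [u ^ u]conjgE mulKg conjgE mulVKg.
have -> : u = w * v^-1.
  apply: (@conjg_inj _ w); rewrite (canRL (mulKg v) E) conjgE.
  by rewrite -!mulgA !mulKg.
by rewrite mulgVK.
Qed.

Lemma quad_defect0P e al x y k :
  quad_defect e al x y k = 1 ->
    al * quad_seq x y k = quad_seq x y (k + Posz e)%R * al.
Proof.
rewrite /quad_defect => /mulg1_eq; rewrite invgK => ->.
by rewrite conjgE invgK !mulgA mulgVK.
Qed.
End QuadSequence.

Lemma quad_seq_morph (H H' : groupType) (f : H -> H') x y k :
  {morph f : x y / x * y} -> f (quad_seq x y k) = quad_seq (f x) (f y) k.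
Proof.
move=> fM; rewrite /quad_seq (morph_conj fM) (morph_zpow fM) fM.
by case: (_ == _).
Qed.

Lemma quad_defect_morph (H H' : groupType) (f : H -> H') e al x y k :
  {morph f : x y / x * y} ->
  f (quad_defect e al x y k) = quad_defect e (f al) (f x) (f y) k.
Proof.
move=> fM; rewrite /quad_defect fM (morph_inv fM) (morph_conj fM) (morph_inv
  fM).
by rewrite !(quad_seq_morph _ _ _ fM).
Qed.

Section QuadLifts.
Variables (K E : groupType) (pi : E -> K).
Hypothesis piM : {morph pi : x y / x * y}.
Hypothesis piC : forall x y, pi x = 1 -> commute x y.

Variables (e : nat) (al : K) (g : int -> nat -> K).
Hypothesis gP : kernel_rels e 2 al g.
Variables (al' x y : E).
Hypotheses (al'E : pi al' = al) (xE : pi x = g 0%R 1%N) (yE : pi y = g 1%R 1%N).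

Lemma kernel_quad_const k : g k 1%N * g (k + 1)%R 1%N = g 0%R 1%N * g 1%R 1%N.
Proof.
elim/int_step_ind: k => [//|k];
  rewrite -(rel_quad gP) -[(2%:R)%R]/(1 + 1 : int)%R.
by rewrite addrA.
Qed.

Lemma pi_quad_seq k : pi (quad_seq x y k) = g k 1%N.
Proof.
rewrite (quad_seq_morph _ _ _ piM) xE yE.
suff [] : quad_seq (g 0%R 1%N) (g 1%R 1%N) k = g k 1%N /\
  quad_seq (g 0%R 1%N) (g 1%R 1%N) (k + 1)%R = g (k + 1)%R 1%N by [].
elim/int_step_ind: k => [|k]; first by rewrite add0r quad_seq0 quad_seq1.
have J := kernel_rel_quadJ gP k.
rewrite -addrA -[(1 + 1)%R]/(2%:R : int)%R quad_seqS2 -(kernel_quad_const k) -J.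
by split=> -[kE k1E]; split; rewrite ?kE //; apply: conjg_inj k1E.
Qed.

Lemma quad_defect_central k z : commute (quad_defect e al' x y k) z.
Proof.
apply: piC; rewrite piM (morph_inv piM) (morph_conj piM) (morph_inv piM).
rewrite !pi_quad_seq al'E conjgE invgK [al * _]mulgA (rel_conj gP) //.
by rewrite mulgK mulVg.
Qed.

(** A shift by 2 conjugates the sequence by [x * y], and [(x * y) ^ al'^-1] has the same image in K
    as [x * y]. Hence the central defect is merely conjugated, and only the defects at 0 and 1
    matter. *)
Lemma quad_defectS2 k : quad_defect e al' x y (k + 2)%R =
  quad_defect e al' x y k.
Proof.
rewrite {1}/quad_defect addrAC !quad_seqS2 conjJg.
have piJ z z' : pi z = pi z' -> forall w, w ^ z = w ^ z'.
  by move=> zz' w; apply: (lift_conj piM piC).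
rewrite (piJ ((x * y) ^ al'^-1) (x * y)).
  by rewrite -conjVg -conjMg central_conj // => z; apply: quad_defect_central.
rewrite (morph_conj piM) (morph_inv piM) al'E piM xE yE.
have alJ k' : g (k' + Posz e)%R 1%N ^ al =
  g k' 1%N by apply: (kernel_rel_conj gP).
apply: (@conjg_inj _ al).
rewrite conjgKV -[in RHS](kernel_quad_const (0 + Posz e)%R) addrAC conjMg !alJ.
by rewrite add0r.
Qed.

Lemma quad_kernel_rels :
  quad_defect e al' x y 0%R = 1 -> quad_defect e al' x y 1%R = 1 ->
  kernel_rels e 2 al' (fun k _ => quad_seq x y k).
Proof.
move=> d0 d1; have dk k : quad_defect e al' x y k = 1.
  suff [] : quad_defect e al' x y k = 1 /\ quad_defect e al' x y (k + 1)%R =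
    1 by [].
  elim/int_step_ind: k => [//|k]; rewrite -addrA -[(1 + 1)%R]/(2%:R : int)%R.
  by rewrite quad_defectS2; split=> -[].
split.
- move=> k; rewrite quad_seq_mul -[(2%:R)%R]/(1 + 1 : int)%R addrA.
  exact: quad_seq_mul.
- by move=> k [|[|i]].
- by move=> k [|i].
- by move=> k [|i] [|[|j]].
by move=> k i _; apply: quad_defect0P.
Qed.
End QuadLifts.

(** * A group of Weyl type *)

Section Equivariant.
Variables (I T : Type) (z : I -> T -> T).

(** Commutation with the operators [z a] is built in, so that those among them that are bijections
    of this kind become central. The Weyl and spin groups are both of this form. *)
Record eqbij := EqBij {
  eqbij_fun :> T -> T;
  eqbij_inv : T -> T;
  eqbij_funK : cancel eqbij_fun eqbij_inv;
  eqbij_invK : cancel eqbij_inv eqbij_fun;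
  eqbijC a u : eqbij_fun (z a u) = z a (eqbij_fun u) }.

Lemma eqbij_eq (f g : eqbij) : f =1 g -> f = g.
Proof.
case: f g => f f' fK f'K fC [g g' gK g'K gC] /= fg.
have {}fg : f = g by apply/funext.
case: g / fg gK g'K gC => gK g'K gC.
have {}fg : f' = g' by apply/funext => x; rewrite -{1}(g'K x) fK.
case: g' / fg gK g'K => gK g'K.
by congr EqBij; apply: Prop_irrelevance.
Qed.

HB.instance Definition _ := gen_eqMixin eqbij.
HB.instance Definition _ := gen_choiceMixin eqbij.

Lemma eqbij_invC (f : eqbij) a u : eqbij_inv f (z a u) = z a (eqbij_inv f u).
Proof. by rewrite -{1}(eqbij_invK f u) -eqbijC eqbij_funK. Qed.

Lemma eqbij_compC (f g : eqbij) a u : f (g (z a u)) = z a (f (g u)).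
Proof. by rewrite !eqbijC. Qed.

Definition eqbij_comp (f g : eqbij) : eqbij :=
  EqBij (can_comp (eqbij_funK f) (eqbij_funK g))
        (can_comp (eqbij_invK g) (eqbij_invK f)) (eqbij_compC f g).
Definition eqbij_id : eqbij :=
  @EqBij id id (frefl _) (frefl _) (fun _ _ => erefl).
Definition eqbij_sym (f : eqbij) : eqbij :=
  EqBij (eqbij_invK f) (eqbij_funK f) (eqbij_invC f).

Lemma eqbij_compA : associative eqbij_comp.
Proof. by move=> f g h; apply: eqbij_eq. Qed.
Lemma eqbij_comp1 : left_id eqbij_id eqbij_comp.
Proof. by move=> f; apply: eqbij_eq. Qed.
Lemma eqbij_comp1r : right_id eqbij_id eqbij_comp.
Proof. by move=> f; apply: eqbij_eq. Qed.
Lemma eqbij_compV : left_inverse eqbij_id eqbij_sym eqbij_comp.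
Proof. by move=> f; apply: eqbij_eq => x /=; rewrite eqbij_funK. Qed.
Lemma eqbij_compVr : right_inverse eqbij_id eqbij_sym eqbij_comp.
Proof. by move=> f; apply: eqbij_eq => x /=; rewrite eqbij_invK. Qed.

HB.instance Definition _ := isGroup.Build eqbij
  eqbij_compA eqbij_comp1 eqbij_comp1r eqbij_compV eqbij_compVr.
End Equivariant.

(* The monomial X^x q^m of a Laurent polynomial ring is encoded by (x, m). Then
   weyl_shift d multiplies by X^d, weyl_cross n substitutes q X_n for X_n and
   exchanges X_n and X_(n+1), and weyl_center a multiplies by q^-a. *)
Section Weyl.
Local Open Scope ring_scope.

Definition monomial : Type := ((nat -> int) * int)%type.
Implicit Types (x d : nat -> int) (m a : int).

Definition swap_at (n i : nat) : nat :=
  if i == n then n.+1 else if i == n.+1 then n else i.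

Lemma swap_at_id n i : i != n -> i != n.+1 -> swap_at n i = i.
Proof. by rewrite /swap_at => /negbTE -> /negbTE ->. Qed.

Lemma swap_atl n : swap_at n n = n.+1.
Proof. by rewrite /swap_at eqxx. Qed.

Lemma swap_atr n : swap_at n n.+1 = n.
Proof. by rewrite /swap_at (gtn_eqF (ltnSn n)) eqxx. Qed.

Lemma swap_atK n : involutive (swap_at n).
Proof.
move=> i; have [->|ni] := eqVneq i n; first by rewrite swap_atl swap_atr.
have [->|nSi] := eqVneq i n.+1; first by rewrite swap_atr swap_atl.
by rewrite !swap_at_id.
Qed.

Definition weyl_center_fun a (u : monomial) : monomial := (u.1, u.2 - a).
Local Notation weyl := (eqbij weyl_center_fun).

Definition weyl_shift_fun d (u : monomial) : monomial :=
  ((fun i => u.1 i + d i), u.2).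

Lemma weyl_shiftK d : cancel (weyl_shift_fun d) (weyl_shift_fun (fun i => - d
  i)).
Proof. by case=> x m; congr pair; apply/funext => i; rewrite /= addrK. Qed.

Lemma weyl_shiftVK d :
  cancel (weyl_shift_fun (fun i => - d i)) (weyl_shift_fun d).
Proof. by case=> x m; congr pair; apply/funext => i; rewrite /= addrNK. Qed.

Definition weyl_shift d : weyl :=
  EqBij (weyl_shiftK d) (weyl_shiftVK d) (fun _ _ => erefl).

Definition weyl_cross_fun n (u : monomial) : monomial :=
  ((fun i => u.1 (swap_at n i)), u.2 + u.1 n).
Definition weyl_cross_inv n (u : monomial) : monomial :=
  ((fun i => u.1 (swap_at n i)), u.2 - u.1 n.+1).

Lemma weyl_crossK n : cancel (weyl_cross_fun n) (weyl_cross_inv n).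
Proof.
case=> x m; congr pair; first by apply/funext => i; rewrite /= swap_atK.
by rewrite /= swap_atr addrK.
Qed.

Lemma weyl_crossVK n : cancel (weyl_cross_inv n) (weyl_cross_fun n).
Proof.
case=> x m; congr pair; first by apply/funext => i; rewrite /= swap_atK.
by rewrite /= swap_atl addrNK.
Qed.

Lemma weyl_crossC n a u :
  weyl_cross_fun n (weyl_center_fun a u) =
    weyl_center_fun a (weyl_cross_fun n u).
Proof. by congr pair; rewrite /= addrAC. Qed.

Definition weyl_cross n : weyl :=
  EqBij (weyl_crossK n) (weyl_crossVK n) (weyl_crossC n).

Lemma weyl_centerK a : cancel (weyl_center_fun a) (weyl_center_fun (- a)).
Proof. by case=> x m; congr pair; rewrite /= opprK addrNK. Qed.

Lemma weyl_centerVK a : cancel (weyl_center_fun (- a)) (weyl_center_fun a).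
Proof. by case=> x m; congr pair; rewrite /= opprK addrK. Qed.

Lemma weyl_centerC a b u :
  weyl_center_fun a (weyl_center_fun b u) =
    weyl_center_fun b (weyl_center_fun a u).
Proof. by congr pair; rewrite /= addrAC. Qed.

Definition weyl_center_elt a : weyl :=
  EqBij (weyl_centerK a) (weyl_centerVK a) (weyl_centerC a).

Lemma weyl_centerD a b :
  weyl_center_elt (a + b) = (weyl_center_elt a * weyl_center_elt b)%g.
Proof. by apply: eqbij_eq => -[x m]; congr pair;
  rewrite /= opprD addrA addrAC. Qed.

Lemma weyl_center_commute a (f : weyl) : commute (weyl_center_elt a) f.
Proof. by apply: eqbij_eq => u; rewrite [RHS]eqbijC. Qed.

Lemma weyl_center_inj : injective weyl_center_elt.
Proof.
move=> a b /(congr1 (fun f : weyl => (f ((fun=> 0), 0)).2)) /=.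
by rewrite !sub0r; apply: oppr_inj.
Qed.

Definition weyl_center : central_emb int weyl :=
  CentralEmb weyl_centerD weyl_center_commute weyl_center_inj.

Let unit0 (i : nat) : int := (i == 0%N)%:R.
Definition weyl_gen (i : nat) : weyl :=
  if i is n.+1 then weyl_cross n else weyl_shift unit0.

Local Notation sg := weyl_gen.

(** This is the only Artin relation of type B that fails, by a factor q; it is what detects the
    class of [lift_quad]. *)
Lemma weyl_quad : (sg 0 * sg 1 * sg 0 * sg 1)%g =
  (sg 1 * sg 0 * sg 1 * sg 0 * weyl_center 1%R)%g.
Proof.
apply: eqbij_eq => -[x m]; congr pair => /=; last by rewrite /unit0 /=; ring.
by apply/funext => -[|[|i]]; rewrite /unit0 /= ?addr0.
Qed.

Lemma weyl_comm0 i : (1 < i)%N -> commute (sg 0) (sg i).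
Proof.
case: i => [|[|i]] // _; apply: eqbij_eq => -[x m]; congr pair => /=.
  apply/funext => j; rewrite /unit0 (_ : (swap_at i.+1 j == 0%N) =
    (j == 0%N)) //.
  by rewrite /swap_at; case: (j =P i.+1) => [->|_] //;
    case: (j =P i.+2) => [->|_].
by rewrite /unit0 /= addr0.
Qed.

Lemma weyl_braid i : (0 < i)%N ->
  (sg i * sg i.+1 * sg i)%g = (sg i.+1 * sg i * sg i.+1)%g.
Proof.
case: i => // n _; apply: eqbij_eq => -[x m].
have s0 : swap_at n.+1 n = n by rewrite swap_at_id; lia.
have s2 : swap_at n n.+2 = n.+2 by rewrite swap_at_id; lia.
congr pair => /=.
  apply/funext => j; congr x.
  have [->|j0] := eqVneq j n; first by rewrite !(swap_atl, swap_atr, s0, s2).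
  have [->|j1] := eqVneq j n.+1; first by rewrite !(swap_atl, swap_atr, s0, s2).
  have [->|j2] := eqVneq j n.+2; first by rewrite !(swap_atl, swap_atr, s0, s2).
  by rewrite !swap_at_id.
rewrite !(swap_atl, swap_atr, s0, s2).
ring.
Qed.

Lemma weyl_comm i j : (0 < i)%N -> (i.+1 < j)%N -> commute (sg i) (sg j).
Proof.
case: i j => // n [//|k] _ nk; apply: eqbij_eq => -[x m].
have [s1 s2 s3 s4] : [/\ swap_at n k = k, swap_at n k.+1 = k.+1,
    swap_at k n = n & swap_at k n.+1 = n.+1].
  by split; rewrite swap_at_id; lia.
congr pair => /=; last by rewrite s1 s3 addrAC.
apply/funext => i; congr x.
have [->|i0] := eqVneq i n;
  first by rewrite !(swap_atl, swap_atr, s1, s2, s3, s4).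
have [->|i1] := eqVneq i n.+1;
  first by rewrite !(swap_atl, swap_atr, s1, s2, s3, s4).
have [->|i2] := eqVneq i k;
  first by rewrite !(swap_atl, swap_atr, s1, s2, s3, s4).
have [->|i3] := eqVneq i k.+1;
  first by rewrite !(swap_atl, swap_atr, s1, s2, s3, s4).
by rewrite !swap_at_id.
Qed.

(** The formal monomial with all exponents equal to [c] is symmetric in the variables, so the
    substitution only extracts the scalar q^c from it. *)
Lemma weyl_shift_const (c : int) i : (0 < i)%N ->
  [~ weyl_shift (fun=> c), sg i]%g = weyl_center c.
Proof.
case: i => // n _; apply: (@mulgI _ (sg n.+1 * weyl_shift (fun=> c))%g).
rewrite -commgC; apply: eqbij_eq => -[x m]; congr pair => /=.
ring.
Qed.
End Weyl.

(** * A spin group *)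

Section Clifford.
Local Open Scope ring_scope.

Definition anticommuting_roots (R : pzRingType) r (E : nat -> R) : Prop :=
  (forall i, (i < r)%N -> E i * E i = 1) /\
  (forall i j, (i < r)%N -> (j < r)%N -> i != j -> E i * E j = - (E j * E i)).

(** The size doubles at each step: the old roots become the block diagonal matrices with blocks
    [E i] and [- E i], and the matrix exchanging the two blocks is the new root. *)
Lemma clifford_matrices (R : nzRingType) r :
  exists n (E : nat -> 'M[R]_n.+1), anticommuting_roots r E.
Proof.
elim: r => [|r [n [E [E1 EC]]]]; first by exists 0%N, (fun=> 0).
pose A (i : nat) : 'M[R]_(n.+1 + n.+1) :=
  if (i < r)%N then block_mx (E i) 0 0 (- E i) else block_mx 0 1%:M 1%:M 0.
exists (n + n.+1)%N, A.
have A1 i : (i < r.+1)%N -> A i *m A i = 1%:M.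
  rewrite /A ltnS => ir; case: ifP => i_r; rewrite mulmx_block.
    rewrite !mul0mx !mulmx0 !addr0 !add0r mulNmx mulmxN opprK.
    by rewrite -[E i *m E i]/(E i * E i) E1 // -scalar_mx_block.
  by rewrite !mul0mx !mulmx0 !addr0 !add0r !mul1mx -scalar_mx_block.
have AC i j : (i < r.+1)%N -> (j < r.+1)%N -> i != j ->
  A i *m A j = - (A j *m A i).
  rewrite /A !ltnS => ir jr ij; case: ifP => i_r; case: ifP => j_r.
  - rewrite !mulmx_block !mul0mx !mulmx0 !addr0 !add0r !mulNmx !mulmxN !opprK.
    by rewrite -[E i *m E j]/(E i * E j) EC // opp_block_mx oppr0.
  - by rewrite !mulmx_block !mul0mx !mulmx0 !addr0 !add0r !mulmx1 !mul1mx
      opp_block_mx oppr0 opprK.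
  - by rewrite !mulmx_block !mul0mx !mulmx0 !addr0 !add0r !mulmx1 !mul1mx
      opp_block_mx oppr0 opprK.
  by case/eqP: ij; lia.
by split.
Qed.

Variables (R : nzRingType) (r : nat) (E : nat -> R).
Hypothesis EP : anticommuting_roots r E.
Hypothesis R3 : (1 + 1 : R) = -1.

(** The root e_i - e_(i+1) of type A in the Clifford algebra. Its square is 2, that is, -1 in
    characteristic 3, so that no division by a square root of 2 is called for. *)
Definition spin_root i : R := E i - E i.+1.
Local Notation t := spin_root.

Lemma spin_root_sqr i : (i.+1 < r)%N -> t i * t i = -1.
Proof.
move=> ir; have i_r := ltnW ir; case: EP => E1 EC.
rewrite /t mulrBl !mulrBr !E1 // [E i.+1 * E i]EC ?(gtn_eqF (ltnSn i)) //.
by rewrite opprB opprK addrACA addNr addr0.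
Qed.

Lemma spin_root_anticomm i j : (i.+1 < j)%N -> (j.+1 < r)%N ->
  t i * t j = - (t j * t i).
Proof.
move=> ij jr; case: EP => _ EC.
have C k l : (k <= i.+1)%N -> (j <= l <= j.+1)%N -> E l * E k = - (E k * E l).
  by move=> ki jl; apply: EC; lia.
rewrite /t !mulrBl !mulrBr (C i j) ?(C i.+1 j) ?(C i j.+1) ?(C i.+1 j.+1);
  try lia.
by rewrite !opprD !opprK addrACA.
Qed.

(** With [x = t i] and [y = t i.+1], [x * y + y * x = -2 = 1]; as both squares are -1, the two sides
    equal [x + y]. *)
Lemma spin_root_braid i : (i.+2 < r)%N ->
  t i * t i.+1 * t i = t i.+1 * t i * t i.+1.
Proof.
move=> ir; case: EP => E1 EC.
have [i0 i1] : (i < r)%N /\ (i.+1 < r)%N by lia.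
pose S := E i * E i.+1 - E i * E i.+2 + E i.+1 * E i.+2.
have xyE : t i * t i.+1 = S - 1.
  by rewrite /t !mulrBl !mulrBr E1 // opprB addrA.
have yxE : t i.+1 * t i = - S - 1.
  rewrite /t !mulrBl !mulrBr E1 // (EC i.+1 i) ?(EC i.+2 i) ?(EC i.+2 i.+1);
    try lia.
  by rewrite !opprD !opprK addrAC addrA.
have {}xyE : t i * t i.+1 = 1 - t i.+1 * t i.
  by rewrite yxE xyE opprD !opprK addrCA R3.
have yxE' : t i.+1 * t i = 1 - t i * t i.+1 by rewrite xyE opprB addrC subrK.
transitivity (t i + t i.+1).
  by rewrite xyE mulrBl mul1r -mulrA spin_root_sqr // mulrN1 opprK.
by rewrite yxE' mulrBl mul1r -mulrA spin_root_sqr // mulrN1 opprK addrC.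
Qed.

Definition spin_center_fun (a : 'Z_2) (u : R) : R := (-1) ^+ a * u.
Local Notation spin := (eqbij spin_center_fun).

Lemma spin_centerK a : involutive (spin_center_fun a).
Proof. by move=> u; rewrite /spin_center_fun mulrA -expr2 sqrr_sign mul1r. Qed.

Lemma spin_center_funD a b u :
  spin_center_fun (a + b) u = spin_center_fun a (spin_center_fun b u).
Proof. by rewrite /spin_center_fun mulrA -exprD /= modn2 signr_odd. Qed.

Lemma spin_center_funC a b u :
  spin_center_fun a (spin_center_fun b u) =
    spin_center_fun b (spin_center_fun a u).
Proof. by rewrite -!spin_center_funD addrC. Qed.

Definition spin_center_elt a : spin :=
  EqBij (spin_centerK a) (spin_centerK a) (spin_center_funC a).

Lemma spin_centerD a b :
  spin_center_elt (a + b) = (spin_center_elt a * spin_center_elt b)%g.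
Proof. by apply: eqbij_eq => u; apply: spin_center_funD. Qed.

Lemma spin_center_commute a (f : spin) : commute (spin_center_elt a) f.
Proof. by apply: eqbij_eq => u; rewrite [RHS]eqbijC. Qed.

Lemma spin_center_inj : injective spin_center_elt.
Proof.
have ne1 : (1 : R) != -1.
  by rewrite -R3 -subr_eq0 opprD addrA subrr sub0r oppr_eq0 oner_eq0.
move=> a b /(congr1 (fun f : spin => f 1)); rewrite /= /spin_center_fun !mulr1.
case: a b => -[|[|a]] // a2 [[|[|b]] // b2]; rewrite /= ?expr0 ?expr1.
- by move=> _; apply: val_inj.
- by move/eqP; rewrite (negbTE ne1).
- by move/esym/eqP; rewrite (negbTE ne1).
by move=> _; apply: val_inj.
Qed.

Definition spin_center : central_emb 'Z_2 spin :=
  CentralEmb spin_centerD spin_center_commute spin_center_inj.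

(** The identity is the default when [x * x] is not -1, so that every [x] yields a bijection. *)
Definition spin_mul_fun (x u : R) : R := if x * x == -1 then x * u else u.
Definition spin_mul_inv (x u : R) : R := if x * x == -1 then - (x * u) else u.

Lemma spin_mulK x : cancel (spin_mul_fun x) (spin_mul_inv x).
Proof.
rewrite /spin_mul_fun /spin_mul_inv => u; case: eqP => // xx.
by rewrite mulrA xx mulN1r opprK.
Qed.

Lemma spin_mulVK x : cancel (spin_mul_inv x) (spin_mul_fun x).
Proof.
rewrite /spin_mul_fun /spin_mul_inv => u; case: eqP => // xx.
by rewrite mulrN mulrA xx mulN1r opprK.
Qed.

Lemma spin_mulC x a u :
  spin_mul_fun x (spin_center_fun a u) = spin_center_fun a (spin_mul_fun x u).
Proof.
rewrite /spin_mul_fun /spin_center_fun; case: ifP => // _.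
by rewrite !mulrA; congr (_ * _); apply/commr_sign.
Qed.

Definition spin_mul x : spin :=
  EqBij (spin_mulK x) (spin_mulVK x) (spin_mulC x).

Definition spin_gen i : spin := spin_mul (t i).

Lemma spin_genE i u : (i.+1 < r)%N -> spin_gen i u = t i * u.
Proof. by move=> ir; rewrite /= /spin_mul_fun spin_root_sqr ?eqxx. Qed.

Lemma spin_gen_braid i : (i.+2 < r)%N ->
  (spin_gen i * spin_gen i.+1 * spin_gen i =
    spin_gen i.+1 * spin_gen i * spin_gen i.+1)%g.
Proof.
move=> ir; apply: eqbij_eq => u.
rewrite -[LHS]/(spin_gen i (spin_gen i.+1 (spin_gen i u))).
rewrite -[RHS]/(spin_gen i.+1 (spin_gen i (spin_gen i.+1 u))).
by rewrite !spin_genE ?(ltnW ir) // !mulrA spin_root_braid.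
Qed.

Lemma spin_gen_comm i j : (i.+1 < j)%N -> (j.+1 < r)%N ->
  (spin_gen i * spin_gen j = spin_gen j * spin_gen i * spin_center 1%R)%g.
Proof.
move=> ij jr; apply: eqbij_eq => u.
rewrite -[LHS]/(spin_gen i (spin_gen j u)).
rewrite -[RHS]/(spin_gen j (spin_gen i (spin_center_fun 1 u))).
have ir : (i.+1 < r)%N by lia.
rewrite !spin_genE //.
by rewrite /spin_center_fun /= expr1 !mulrA mulrN1 spin_root_anticomm.
Qed.
End Clifford.

(** * A criterion for the computation of H_2 *)

Section Additive.
Local Open Scope ring_scope.

Lemma additive_of (A B : zmodType) (f : A -> B) :
  zmod_morphism f -> exists g : {additive A -> B}, g =1 f.
Proof.
move=> fB; exists (HB.pack_for {additive A -> B} f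
  (GRing.isZmodMorphism.Build _ _ f fB)); exact: frefl.
Qed.

Lemma additive_mulz (Q : zmodType) (q : Q) :
  exists j : {additive int -> Q}, forall m, j m = q *~ m.
Proof. by apply: additive_of => m n; rewrite mulrzBr. Qed.

Lemma additive_Z2 (Q : zmodType) (q : Q) : q *+ 2 = 0 ->
  exists j : {additive 'Z_2 -> Q}, forall b, j b = q *+ b.
Proof.
move=> q2; apply: additive_of => a b.
case: a b => -[|[|a]] // a2 [[|[|b]] // b2];
  rewrite /= ?mulr0n ?mulr1n ?subr0 ?subrr //.
by apply/eqP; rewrite sub0r -addr_eq0 -mulr2n q2.
Qed.
End Additive.

(** * Functionals dual to chosen classes of cycles *)

Section DualPair.
Local Open Scope ring_scope.
Variables (K : groupType).
Local Notation Q := (bar_coker K).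

Definition dual_pair (A : zmodType) (phi : {additive Q ->
  A}) (j : {additive A -> Q}) :=
  (forall a, bar_coker_bd (j a) = 0) /\ cancel j phi.

Lemma dual_pair_int (phi : {additive Q -> int}) q :
  bar_coker_bd q = 0 -> phi q = 1 ->
  exists2 j, dual_pair phi j & forall m, j m = q *~ m.
Proof.
move=> bq q1; have [j jE] := additive_mulz q; exists j => //.
by split=> m; rewrite jE raddfMz ?bq ?mul0rz // q1 intz.
Qed.

Lemma dual_pair_Z2 (phi : {additive Q -> 'Z_2}) q :
  bar_coker_bd q = 0 -> q *+ 2 = 0 -> phi q = 1 ->
  exists2 j, dual_pair phi j & forall b, j b = q *+ b.
Proof.
move=> bq q2 q1; have [j jE] := additive_Z2 q2; exists j => //.
by split=> b; rewrite jE raddfMn ?bq ?mul0rn // q1 natr_Zp.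
Qed.

Lemma dual_pair_prod (A B : zmodType) (f : {additive Q -> A}) i
    (g : {additive Q -> B}) j :
  dual_pair f i -> dual_pair g j -> (forall a, g (i a) = 0) ->
    (forall b, f (j b) = 0) ->
  exists (h : {additive Q -> A * B}) (k : {additive A * B -> Q}),
    [/\ dual_pair h k, forall q, h q = (f q, g q) & forall a b, k (a, b) =
      i a + j b].
Proof.
move=> [bi iK] [bj jK] gi fj.
have [|h hE] := additive_of (f := fun q => (f q, g q)).
  by move=> p q; rewrite !raddfB.
have [|k kE] := additive_of (f := fun ab => i ab.1 + j ab.2).
  by move=> p q; rewrite !raddfB /= opprD addrACA.
exists h, k; split; last by move=> a b; rewrite kE.
  split; first by move=> ab; rewrite kE raddfD bi bj addr0.
  by move=> [a b]; rewrite kE hE !raddfD /= iK jK gi fj addr0 add0r.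
exact: hE.
Qed.
End DualPair.

Lemma kernel_lift_ext e r (H : groupType) (al : H) y y' :
  (forall k i, 0 < i < r -> y k i = y' k i) ->
  kernel_lift (e := e) (r := r) al y =1 kernel_lift al y'.
Proof.
move=> yy' g; rewrite /kernel_lift; congr (_ * _).
elim: (repr _) (0%R : int) => [//|[i b] u IHu] k /=.
by case: eqP => i0; rewrite IHu // yy' // lt0n ltn_ord andbT; apply/eqP.
Qed.

Section Criterion.
Variables (e r : nat).
Hypotheses (e_gt0 : 0 < e) (r_gt1 : 1 < r).
Local Notation K := (complex_braid_group e r).
Local Notation Q := (bar_coker K).
Local Notation tau := (univ_cocycle K).

(** The hypothesis is applied to [psi = id - j phi], which kills the image of [j]. By the
    presentation of K, generators lifted with their relations give the section that [H2_iso]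
    requires. *)
Lemma H2_iso_rels (A : zmodType) (phi : {additive Q -> A}) j :
  dual_pair phi j ->
  (forall psi : {additive Q -> Q}, (forall a, psi (j a) = 0%R) ->
    exists (al : cext (cocycle_push tau psi)) y,
      [/\ kernel_rels e r al y, al.1 = braid_al e r &
          forall k i, 0 < i < r -> (y k i).1 = braid_y e r k i]) ->
  zmod_iso (group_homology K 2) A.
Proof.
move=> [bj jK] split.
have [|psi psiE] := additive_of (f := fun q : Q => (q - j (phi q))%R).
  by move=> p q; rewrite /= !raddfB addrACA.
have psij a : psi (j a) = 0%R by rewrite psiE jK subrr.
have [al [y [yP alE yE]]] := split psi psij.
apply: (@H2_iso _ _ phi j psi (kernel_lift al y)) => //.
  exact: (kernel_liftM r_gt1 e_gt0 yP).
move=> g; rewrite -[LHS]/(cext_pi _) (morph_kernel_lift _ _ _ (@cext_piM _ _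
  _)).
rewrite [cext_pi al]alE (kernel_lift_ext _ (y' := braid_y e r)) //.
exact: kernel_lift_id.
Qed.
End Criterion.

(** * The free part in rank at least 3 *)

Section Classes.
Variable K : groupType.
Local Notation Q := (bar_coker K).
Local Notation tau := (univ_cocycle K).
Local Notation E := (cext tau).

Lemma cycle_class (x : E) : cext_pi x = 1 -> univ_theta x = 0%R ->
  exists q, x = cext_in tau q /\ bar_coker_bd q = 0%R.
Proof.
by move=> /cext_piP[q ->]; rewrite univ_theta_in => q0; exists q.
Qed.

Lemma univ_thetaR (x y : E) : univ_theta [~ x, y] = 0%R.
Proof. by rewrite commgEl univ_thetaM univ_thetaV univ_thetaJ addNr. Qed.

Lemma comm_class (x y : K) : commute x y ->
  exists q, lift_comm (cext_sec tau) x y = cext_in tau q /\ bar_coker_bd q =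
    0%R.
Proof.
move=> xy; apply: cycle_class; last exact: univ_thetaR.
by rewrite (morph_comm (@cext_piM _ _ _)) !cext_secK; apply/eqP/commgP.
Qed.

Variable psi : {additive Q -> Q}.
Local Notation tau' := (cocycle_push tau psi).

Definition push_map : E -> cext tau' := cext_map tau' id psi.

Lemma push_mapM : {morph push_map : x y / x * y}.
Proof. exact: cext_mapM. Qed.

Lemma push_map_in q : push_map (cext_in tau q) = cext_in tau' (psi q).
Proof. exact: cext_map_in. Qed.

Lemma push_map_sec : push_map \o cext_sec tau = cext_sec tau'.
Proof. by apply/funext => g; apply: cext_map_sec. Qed.

Lemma push_map_kill x q : x = cext_in tau q -> psi q = 0%R -> push_map x = 1.
Proof. by move=> -> q0; rewrite push_map_in q0 cext_in0. Qed.
End Classes.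

(** * Values of the functionals on the defects of the relations *)

Section Evaluation.
Variables (e r : nat).
Hypotheses (e_gt0 : 0 < e) (r_gt1 : 1 < r).
Local Notation K := (complex_braid_group e r).
Local Notation Q := (bar_coker K).
Local Notation tau := (univ_cocycle K).
Local Notation s := (cext_sec tau).
Local Notation g := (braid_y e r).
Local Notation al := (braid_al e r).

Variables (A : zmodType) (G : groupType) (iota : central_emb A G).
Variables (al0 : G) (y0 : int -> nat -> G).
Variables (phi : {additive Q -> A}) (Phi : cext tau -> G).

Definition evaluation :=
  [/\ {morph Phi : x y / x * y},
      forall q, Phi (cext_in _ q) = iota (phi q),
      exists a, Phi (s al) = al0 * iota a &
      forall k i, 0 < i < r -> exists a, Phi (s (g k i)) = y0 k i * iota a].

Hypothesis evalP : evaluation.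

Lemma central_conjg (u v : G) a b : (u * iota a) ^ (v * iota b) =
  u ^ v * iota a.
Proof.
rewrite conjMg (central_conj _ (central_funC iota a)); congr (_ * _).
by rewrite conjgM [LHS]conjgE -central_funC mulKg.
Qed.

Lemma central_commg (u v : G) a b : [~ u * iota a, v * iota b] = [~ u, v].
Proof.
rewrite !commgEl central_conjg -(central_funC iota a u) invgM.
by rewrite -(central_funC iota a (u ^ v)) -mulgA mulKg.
Qed.

(** The unknown central factors of the values of [Phi] at the generators drop out of a
    commutator. *)
Lemma eval_comm k i j q t : 0 < i < r -> 0 < j < r ->
  lift_comm s (g k i) (g k j) = cext_in tau q ->
  [~ y0 k i, y0 k j] = iota t -> phi q = t.
Proof.
case: evalP => PhiM Phi_in _ Phi_y ir jr qE yE.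
apply: (@central_fun_inj _ _ iota); rewrite -Phi_in -qE (morph_comm PhiM) -yE.
have [[a ->] [b ->]] := (Phi_y k i ir, Phi_y k j jr).
exact: central_commg.
Qed.

Hypothesis r_gt2 : 2 < r.

Lemma eval_torus q t : lift_torus s al g = cext_in tau q ->
  [~ al0, y0 0%R 2] = iota t -> phi q = t.
Proof.
case: evalP => PhiM Phi_in [a aE] Phi_y qE yE.
apply: (@central_fun_inj _ _ iota);
  rewrite -Phi_in -qE (morph_comm PhiM) -yE aE.
have [b ->] := Phi_y 0%R 2%N r_gt2.
exact: central_commg.
Qed.

Lemma eval_quad q t : lift_quad s g 0%R = cext_in tau q ->
  (forall k, braided (y0 0%R 2) (y0 k 1%N)) ->
  y0 1%R 1%N * y0 2%R 1%N = y0 0%R 1%N * y0 1%R 1%N * iota t -> phi q = t.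
Proof.
case: evalP => PhiM Phi_in _ Phi_y qE yB yE.
apply: (@central_fun_inj _ _ iota); rewrite -Phi_in -qE.
have [b bE] := Phi_y 0%R 2%N r_gt2.
(* The same [b] serves for all [k]: the corrected lifts are conjugates of [X], so they inherit its
   unknown factor and lose their own. These factors then cancel in [lift_quad]. *)
have yk k : Phi (lift_y s g k 1) = y0 k 1%N * iota b.
  have [a aE] := Phi_y k 1%N r_gt1.
  rewrite /= (morph_conj PhiM) PhiM aE bE.
  rewrite central_mulM central_conjg.
  by rewrite ((braided_conj _ _).1 (yB k)).
rewrite PhiM (morph_inv PhiM) 2!(PhiM (lift_y _ _ _ _)) !yk !central_mulM
  !add0r yE.
have C x : x * iota t * iota (b + b)%R = x * iota (b + b)%R * iota t.
  by rewrite -!mulgA central_funC.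
by rewrite C mulKg.
Qed.
End Evaluation.

Section ProjectiveRelations.
Variables (A : zmodType) (G : groupType) (iota : central_emb A G).
Local Notation cl := (cquot_class iota).

Lemma cquot_kernel_rels e r al (y : int -> nat -> G) :
  (forall k, exists a,
    y k 1%N * y (k + 1)%R 1%N = y (k + 1)%R 1%N * y (k + 2)%R 1%N * iota a) ->
  (forall k i, 1 < i < r -> exists a, y k i = y (k + 1)%R i * iota a) ->
  (forall k i, 0 < i -> i.+1 < r -> exists a,
    y k i.+1 * y k i * y k i.+1 = y k i * y k i.+1 * y k i * iota a) ->
  (forall k i j, 0 < i -> i.+1 < j -> j < r -> exists a,
    y k j * y k i = y k i * y k j * iota a) ->
  (forall (k : int) i, 0 < i < r -> exists a,
    y (k + Posz e)%R i * al = al * y k i * iota a) ->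
  kernel_rels e r (cl al) (fun k i => cl (y k i)).
Proof.
have cl2 u v : cl u * cl v = cl (u * v) by rewrite -cquot_classM.
have cl3 u v w : cl u * cl v * cl w = cl (u * v * w) by rewrite !cquot_classM.
move=> quad shift braid comm conj; split.
- by move=> k; rewrite !cl2; apply/cquot_classP.
- by move=> k i ir; apply/cquot_classP/shift.
- by move=> k i i0 ir; rewrite !cl3; apply/cquot_classP/braid.
- by move=> k i j i0 ij jr; rewrite /commute !cl2; apply/cquot_classP/comm.
by move=> k i ir; rewrite !cl2; apply/cquot_classP/conj.
Qed.
End ProjectiveRelations.

Lemma kernel_rels_mulr e r (H : groupType) (al c : H) y :
  kernel_rels e r al y -> (forall k i, 0 < i < r -> commute c (y k i)) ->
  kernel_rels e r (al * c) y.
Proof.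
case=> quad shift braid comm conj cC; split=> // k i ir.
by rewrite -mulgA cC // mulgA conj // mulgA.
Qed.

Section WeylConj.
Local Notation sg := weyl_gen.

Definition weyl_conj (k : int) (i : nat) :=
  zpow (sg 0%N) k * sg i * (zpow (sg 0%N) k)^-1.

Lemma weyl_conjE k i : weyl_conj k i = sg i ^ (zpow (sg 0%N) k)^-1.
Proof. by rewrite conjgE invgK mulgA. Qed.

Lemma weyl_conj_const k i : 1 < i -> weyl_conj k i = sg i.
Proof.
by move=> i1; rewrite /weyl_conj -(commute_zpow k (commute_sym (weyl_comm0
  i1))) mulgK.
Qed.

Lemma weyl_conj_braided k : braided (sg 2) (weyl_conj k 1).
Proof.
rewrite -(weyl_conj_const k (i := 2)) // !weyl_conjE /braided -!conjMg.
by rewrite weyl_braid.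
Qed.

Lemma weyl_conj_quad k : weyl_conj (k + 1)%R 1 * weyl_conj (k + 2)%R 1 =
  weyl_conj k 1 * weyl_conj (k + 1)%R 1 * weyl_center 1%R.
Proof.
have -> : (k + 2 = k + 1 + 1)%R by lia.
rewrite /weyl_conj !zpowS; move: (zpow _ k) => z.
rewrite !invgM !mulgA !mulgVK; apply: (@mulIg _ (z * sg 0 * sg 0)).
rewrite -[RHS]mulgA (central_funC weyl_center) !mulgA !mulgVK.
by move: weyl_quad; rewrite -!mulgA => ->.
Qed.

End WeylConj.

Section WeylFunctional.
Variables (e r : nat).
Hypotheses (e_gt0 : 0 < e) (r_gt1 : 1 < r).
Local Notation K := (complex_braid_group e r).
Local Notation sg := weyl_gen.

(** The twist of [al] is a monomial commuting with each [y k i] up to powers of q. Rank at least 3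
    takes [c = 0]; in rank 2 with [e] odd, [c] adjusts the value on the cycle. *)
Lemma weyl_functional (c : int) : exists (phi : {additive bar_coker K ->
  int}) Phi,
  evaluation (e := e) (r :=
    r) weyl_center (sg 0 ^+ e * weyl_shift (fun=> c)) weyl_conj phi Phi.
Proof.
apply: (bar_functional r_gt1 e_gt0 (iota := weyl_center)).
set cl := cquot_class weyl_center.
have clM : {morph cl : x y / x * y} := @cquot_classM _ _ weyl_center.
have clC u v : commute u v -> commute (cl u) (cl v).
  by move=> uv; rewrite /commute -clM uv clM.
have yE k i : cl (weyl_conj k i) =
  zpow (cl (sg 0)) k * cl (sg i) * (zpow (cl (sg 0)) k)^-1.
  by rewrite /weyl_conj 2!clM (morph_inv clM) (morph_zpow clM).
have -> : (fun k i => cl (weyl_conj k i)) =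
    (fun k i => zpow (cl (sg 0)) k * cl (sg i) * (zpow (cl (sg 0)) k)^-1).
  by apply/funext => k; apply/funext => i; rewrite yE.
rewrite clM (morph_exp clM); apply: kernel_rels_mulr.
  apply: artin_kernel_rels.
  - have cl4 u v w x : cl u * cl v * cl w * cl x = cl (u * v * w * x).
      by rewrite !clM.
    by rewrite !cl4; apply/esym/cquot_classP; exists 1%R; rewrite weyl_quad.
  - by move=> i /andP[i1 _]; apply/clC/weyl_comm0.
  - move=> i i0 _; have cl3 u v w : cl u * cl v * cl w = cl (u * v * w).
      by rewrite !clM.
    by rewrite !cl3 weyl_braid.
  by move=> i j i0 ij _; apply/clC/weyl_comm.
move=> k i /andP[i0 _].
have c0 : commute (cl (weyl_shift (fun=> c))) (zpow (cl (sg 0)) k).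
  apply: commute_zpow; apply: clC; apply: eqbij_eq => -[x m]; congr pair => /=.
  by apply/funext => j; rewrite addrAC.
apply: commuteM; last exact: commuteV.
apply: commuteM => //; apply/esym.
have cl2 u v : cl u * cl v = cl (u * v) by rewrite clM.
rewrite !cl2; apply/cquot_classP; exists c.
by rewrite commgC weyl_shift_const.
Qed.
End WeylFunctional.

Section RankAtLeast3.
Variables (e r : nat).
Hypotheses (e_gt0 : 0 < e) (r_gt2 : 2 < r).
Let r_gt1 : 1 < r := ltnW r_gt2.
Local Notation K := (complex_braid_group e r).
Local Notation Q := (bar_coker K).
Local Notation tau := (univ_cocycle K).
Local Notation s := (cext_sec tau).
Local Notation g := (braid_y e r).
Local Notation al := (braid_al e r).
Let gP : kernel_rels e r al g := kernel_braid_rels r_gt1 e_gt0.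

Lemma torus_class :
  exists q, lift_torus s al g = cext_in tau q /\ bar_coker_bd q = 0%R.
Proof.
apply: comm_class; rewrite /commute (rel_conj gP) // !(kernel_rel_const gP _ (i
  := 2)) //.
Qed.

(** The [lift_y k 1] are all conjugate to [X], so the contributions of the four factors to
    [univ_theta] cancel. *)
Lemma quad_class :
  exists q, lift_quad s g 0%R = cext_in tau q /\ bar_coker_bd q = 0%R.
Proof.
apply: cycle_class.
  exact: (pi_lift_quad (@cext_piM _ _ _) (@cext_central _ _ _) (@cext_secK _ _
    _) gP r_gt2).
have yX k : univ_theta (lift_y s g k 1) =
  univ_theta (s (g 0%R 2)) by apply: univ_thetaJ.
rewrite univ_thetaM univ_thetaV 2!(univ_thetaM (lift_y _ _ _ _)) !yX addNr //.
Qed.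

Lemma kernel_comm k i j : 0 < i -> i.+1 < j -> j < r -> commute (g k i) (g k j).
Proof. exact: (rel_comm gP). Qed.

Lemma push_kernel_rels (psi : {additive Q -> Q}) qT qB :
  lift_torus s al g = cext_in tau qT -> psi qT = 0%R ->
  lift_quad s g 0%R = cext_in tau qB -> psi qB = 0%R ->
  (forall k i j, 0 < i -> i.+1 < j -> j < r ->
    exists q, lift_comm s (g k i) (g k j) = cext_in tau q /\ psi q = 0%R) ->
  exists (al' : cext (cocycle_push tau psi)) y',
      [/\ kernel_rels e r al' y', al'.1 = al &
          forall k i, 0 < i < r -> (y' k i).1 = g k i].
Proof.
move=> TE T0 BE B0 CE; pose s' := cext_sec (cocycle_push tau psi).
exists (s' al), (lift_y s' g); split=> //.
  apply: (lift_kernel_rels (@cext_piM _ _ _) (@cext_central _ _ _) (@cext_secK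
    _ _ _) gP r_gt2).
  - by rewrite -(push_map_kill TE T0) -[lift_torus s al g]/(lift_comm _ _ _)
      (lift_comm_morph _ (@push_mapM _ psi)) push_map_sec.
  - by rewrite -(push_map_kill BE B0) (lift_quad_morph _ _ (@push_mapM _ psi))
      push_map_sec.
  move=> k i j i0 ij jr; have [q [qE q0]] := CE k i j i0 ij jr.
  by rewrite -(push_map_kill qE q0) (lift_comm_morph _ (@push_mapM _ psi))
    push_map_sec.
move=> k i ir.
exact: (pi_lift_y (@cext_piM _ _ _) (@cext_central _ _ _) (@cext_secK _ _ _) gP
  r_gt2).
Qed.

Local Notation sg := weyl_gen.
Let const1 : eqbij weyl_center_fun := weyl_shift (fun=> 1%R).

(** With [y k i] independent of [k], every relation holds exactly except the conjugation by [al],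
    which costs a factor q. *)
Lemma torus_functional : exists (phi : {additive Q -> int}) Phi,
  evaluation weyl_center const1 (fun=> sg) phi Phi.
Proof.
apply: (bar_functional r_gt1 e_gt0 (iota := weyl_center));
  apply: cquot_kernel_rels.
- by move=> k; exists 0%R; rewrite central_fun0 mulg1.
- by move=> k i _; exists 0%R; rewrite central_fun0 mulg1.
- by move=> k i i0 _; exists 0%R; rewrite central_fun0 mulg1 weyl_braid.
- move=> k i j i0 ij _; exists 0%R; rewrite central_fun0 mulg1.
  exact/esym/weyl_comm.
move=> _ i /andP[i0 _]; exists (- 1)%R.
rewrite [const1 * _]commgC [ [~ _, _] ]weyl_shift_const // -mulgA -central_funD.
by rewrite subrr central_fun0 mulg1.
Qed.

Lemma free_part : exists qT qB (phi : {additive Q -> int * int}) j,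
  [/\ lift_torus s al g = cext_in tau qT, lift_quad s g 0%R = cext_in tau qB,
      dual_pair phi j & forall a b, j (a, b) = (qT *~ a + qB *~ b)%R].
Proof.
have [qT [TE bT]] := torus_class; have [qB [BE bB]] := quad_class.
have [f [F fP]] := torus_functional.
have [h [G hP]] := weyl_functional e_gt0 r_gt1 0%R.
(* The matrix of values of [f] and [h] on [qT] and [qB] is the identity. *)
have fT : f qT = 1%R by apply: (eval_torus fP r_gt2 TE);
  apply: weyl_shift_const.
have fB : f qB = 0%R.
  apply: (eval_quad r_gt1 fP r_gt2 BE) => [k|]; first by apply/esym/weyl_braid.
  by rewrite central_fun0 mulg1.
have hT : h qT = 0%R.
  apply: (eval_torus hP r_gt2 TE); rewrite central_fun0 weyl_conj_const //.
  apply/eqP/commgP/commute_sym/commuteM;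
    first exact/commuteX/commute_sym/weyl_comm0.
  by apply/commute_sym/commgP; rewrite weyl_shift_const // central_fun0.
have hB : h qB = 1%R.
  apply: (eval_quad r_gt1 hP r_gt2 BE) => [k|].
    by rewrite weyl_conj_const //; apply: weyl_conj_braided.
  by have := weyl_conj_quad 0%R; rewrite !add0r.
have [i fi iE] := dual_pair_int bT fT; have [j hj jE] := dual_pair_int bB hB.
have [||phi [k [phiP _ kE]]] := dual_pair_prod fi hj.
- by move=> a; rewrite iE raddfMz hT mul0rz.
- by move=> b; rewrite jE raddfMz fB mul0rz.
by exists qT, qB, phi, k; split=> // a b; rewrite kE iE jE.
Qed.
End RankAtLeast3.

(** * The torsion in rank at least 4 *)

Lemma torsion_int2 (Q : zmodType) (f : {additive Q -> int * int}) q :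
  (q *+ 2 = 0)%R -> f q = 0%R.
Proof.
move=> /(congr1 f); rewrite raddfMn raddf0 mulr2n; case: (f q) => a b [aa bb].
by congr pair; lia.
Qed.

Lemma natr_mx_F3 n : (1 + 1 : 'M['F_3]_n.+1)%R = (-1)%R.
Proof.
apply/eqP; rewrite -subr_eq0 opprK -[1%R in X in X == _]/(1%:M)%R.
rewrite -!raddfD /= (_ : 1 + 1 + 1 = 0 :> 'F_3)%R ?raddf0 //.
exact/val_inj.
Qed.

Section SpinFunctional.
Variables (e r : nat).
Hypotheses (e_gt0 : 0 < e) (r_gt1 : 1 < r).
Local Notation K := (complex_braid_group e r).

Variables (R : nzRingType) (E : nat -> R).
Hypothesis EP : anticommuting_roots r E.
Hypothesis R3 : (1 + 1 : R)%R = (-1)%R.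
Local Notation sp := (spin_gen E).
Local Notation ce := (spin_center R3).

(** Only the commutation relations fail, by a sign, so this functional isolates the classes of order
    2. *)
Lemma spin_functional : exists (phi : {additive bar_coker K -> 'Z_2}) Phi,
  evaluation (e := e) (r := r) ce 1 (fun _ i => sp i.-1) phi Phi.
Proof.
apply: (bar_functional r_gt1 e_gt0 (iota := ce)); apply: cquot_kernel_rels.
- by move=> k; exists 0%R; rewrite central_fun0 mulg1.
- by move=> k i _; exists 0%R; rewrite central_fun0 mulg1.
- move=> k [//|i] _ ir; exists 0%R; rewrite central_fun0 mulg1.
  exact/esym/(spin_gen_braid EP R3).
- move=> k [//|i] [//|j] _ ij jr; exists 1%R.
  rewrite [in RHS](spin_gen_comm EP R3) // -mulgA -central_funD.
  by rewrite (_ : 1 + 1 = 0 :> 'Z_2)%R ?central_fun0 ?mulg1 //; apply: val_inj.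
by move=> k i _; exists 0%R; rewrite central_fun0 !mulg1 mul1g.
Qed.

Lemma spin_gen_commg i j : i.+1 < j -> j.+1 < r -> [~ sp i, sp j] = ce 1%R.
Proof.
move=> ij jr; apply: (@mulgI _ (sp j * sp i)).
by rewrite -commgC; apply: (spin_gen_comm EP R3).
Qed.

Lemma spin_leaf_comm i j : i.+1 < j -> j.+1 < r ->
  sp j * sp i = sp i * sp j * ce 1%R.
Proof.
move=> ij jr; rewrite [in RHS](spin_gen_comm EP R3) // -mulgA -central_funD.
by rewrite (_ : 1 + 1 = 0 :> 'Z_2)%R ?central_fun0 ?mulg1 //; apply: val_inj.
Qed.

(* For r = 4 and e even, K maps to the Coxeter group of type D_4, and the leaves
   of the diagram are the images of y_(0,1), y_(1,1) and \sigma_4. Identifying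
   one of the first two with the third one yields a morphism to S_4. *)
Definition spin_leaf (p : bool) (k : int) (i : nat) :=
  if i == 1%N then (if ((k %% 2)%Z == 0%R) == p then sp 0%N else sp 2) else sp
    i.-1.

Lemma spin_leaf_functional (p : bool) : r = 4 -> ~~ odd e ->
  exists (phi : {additive bar_coker K -> 'Z_2}) Phi,
    evaluation (e := e) (r := r) ce 1 (spin_leaf p) phi Phi.
Proof.
move=> r4 e_even.
have sp02 : sp 2 * sp 0%N = sp 0%N * sp 2 * ce 1%R.
  rewrite [in RHS](spin_gen_comm EP R3) ?r4 // -mulgA -central_funD.
  by rewrite (_ : 1 + 1 = 0 :> 'Z_2)%R ?central_fun0 ?mulg1 //; apply: val_inj.
have sp20 : sp 0%N * sp 2 = sp 2 * sp 0%N * ce 1%R.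
  by rewrite (spin_gen_comm EP R3) ?r4.
have parS k : ((k + 1) %% 2)%Z == 0%R = ~~ ((k %% 2)%Z == 0%R) by lia.
have par2 k : ((k + 2) %% 2)%Z == 0%R = ((k %% 2)%Z == 0%R) by lia.
apply: (bar_functional r_gt1 e_gt0 (iota := ce)); apply: cquot_kernel_rels.
(* Consecutive [y k 1] are [sp 0] and [sp 2] alternately, so the quadratic relation exchanges two
   anticommuting factors. *)
- move=> k; exists 1%R; rewrite /spin_leaf /= parS par2.
  by case: (_ == 0%R); case: p => /=; (exact: sp02 || exact: sp20).
- move=> k i /andP[i1 _]; exists 0%R; rewrite central_fun0 mulg1 /spin_leaf.
  by rewrite (gtn_eqF i1).
- move=> k [|[|i]] // _ ir; exists 0%R;
    rewrite central_fun0 mulg1 /spin_leaf /=.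
    by case: ifP => _; rewrite (spin_gen_braid EP R3) ?r4.
  by rewrite (spin_gen_braid EP R3).
- move=> k [//|i] [//|j] _ ij jr.
  have [-> ->] : i = 0%N /\ j = 2%N by rewrite r4 in jr; lia.
  rewrite /spin_leaf /=; case: ifP => _; first by exists 1%R.
  by exists 0%R; rewrite -[spin_center_elt _ _]/(ce 0%R) central_fun0 mulg1.
move=> k i _; exists 0%R; rewrite central_fun0 !mulg1 mul1g /spin_leaf.
(* As [e] is even, the shift by [e] preserves the choice of the leaf. *)
have -> // : ((k + Posz e) %% 2)%Z == 0%R = ((k %% 2)%Z == 0%R).
lia.
Qed.
End SpinFunctional.

Section TorsionClasses.
Variables (e r : nat).
Hypotheses (e_gt0 : 0 < e) (r_gt2 : 2 < r).
Let r_gt1 : 1 < r := ltnW r_gt2.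
Local Notation K := (complex_braid_group e r).
Local Notation Q := (bar_coker K).
Local Notation tau := (univ_cocycle K).
Local Notation s := (cext_sec tau).
Local Notation g := (braid_y e r).
Local Notation al := (braid_al e r).
Local Notation cm k i j := (lift_comm s (g k i) (g k j)).
Let gP : kernel_rels e r al g := kernel_braid_rels r_gt1 e_gt0.
Let piM := @cext_piM _ _ tau.
Let piC := @cext_central _ _ tau.
Let sK := @cext_secK _ _ tau.

Lemma H2_rank3 : r = 3 -> zmod_iso (group_homology K 2) (int * int)%type.
Proof.
move=> r3; have [qT [qB [phi [j [TE BE jP jE]]]]] := free_part e_gt0 r_gt2.
apply: (H2_iso_rels e_gt0 r_gt1 jP) => psi psi0.
apply: (push_kernel_rels e_gt0 r_gt2 TE _ BE).
- by have := psi0 (1, 0)%R; rewrite jE mulr0z addr0.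
- by have := psi0 (0, 1)%R; rewrite jE mulr0z add0r.
by move=> k i j' i0 ij jr; exfalso; lia.
Qed.

Hypothesis r_gt3 : 3 < r.

Lemma torsion_class k : exists q,
  [/\ cm k 1 3 = cext_in tau q, bar_coker_bd q = 0%R & (q *+ 2 = 0)%R].
Proof.
have [|q [qE bq]] := @comm_class K (g k 1%N) (g k 3).
  exact: (kernel_comm e_gt0 r_gt2).
exists q; split=> //; apply: (@cext_in_inj _ _ tau).
rewrite mulr2n cext_inD -qE cext_in0 -expg2.
exact: (lift_comm13_sqr piM piC sK gP).
Qed.

(** This covers both [r >= 5] and [r = 4] with [e] odd. The spin functional is 1 on the common
    commutator and 0 on [qT] and [qB], while [phi] kills elements of order 2. *)
Lemma H2_one_torsion :
  (forall k i j, 0 < i -> i.+1 < j -> j < r -> cm k i j = cm 0%R 1 3) ->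
  zmod_iso (group_homology K 2) (int * int * 'Z_2)%type.
Proof.
move=> cm_const; have [qT [qB [phi [j [TE BE jP jE]]]]] :=
  free_part e_gt0 r_gt2.
have [q [qE bq q2]] := torsion_class 0%R.
have [n [E EP]] := clifford_matrices 'F_3 r; have R3 := natr_mx_F3 n.
have [f [F fP]] := spin_functional e_gt0 r_gt1 EP R3.
have fq : f q = 1%R.
  apply: (eval_comm fP (k := 0%R) (i := 1%N) (j := 3)) => //.
  exact: (spin_gen_commg EP R3).
have fT : f qT = 0%R.
  by apply: (eval_torus fP r_gt2 TE); rewrite comm1g central_fun0.
have fB : f qB = 0%R.
  apply: (eval_quad r_gt1 fP r_gt2 BE) => [k|].
    exact/esym/(spin_gen_braid EP R3).
  by rewrite central_fun0 mulg1.
have [i fi iE] := dual_pair_Z2 bq q2 fq.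
have [||Phi [J [JP _ JE]]] := dual_pair_prod jP fi.
- by move=> [a b]; rewrite jE raddfD !raddfMz fT fB !mul0rz addr0.
- move=> b; rewrite iE raddfMn.
  by rewrite torsion_int2 // mul0rn.
apply: (H2_iso_rels e_gt0 r_gt1 JP) => psi psi0.
apply: (push_kernel_rels e_gt0 r_gt2 TE _ BE).
- by have := psi0 (1, 0, 0)%R; rewrite JE jE iE mulr0z !addr0.
- by have := psi0 (0, 1, 0)%R; rewrite JE jE iE mulr0z add0r addr0.
move=> k i' j' i0 ij jr; exists q; rewrite cm_const //; split=> //.
by have := psi0 (0, 0, 1)%R; rewrite JE jE iE !mulr0z !add0r.
Qed.

Lemma H2_rank_ge5 : 4 < r ->
  zmod_iso (group_homology K 2) (int * int * 'Z_2)%type.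
Proof.
move=> r_gt4; apply: H2_one_torsion => k i j i0 ij jr.
by rewrite !(lift_comm_const piM piC sK gP).
Qed.

Lemma torsion_parity k m : cm (k + m%:Z * 2)%R 1 3 = cm k 1 3.
Proof.
elim: m => [|m IHm]; first by rewrite mul0r addr0.
rewrite -addn1 PoszD mulrDl mul1r addrA.
by rewrite (lift_comm_shift2 piM piC sK gP).
Qed.

Lemma torsion_parityz k : cm k 1 3 = cm (k %% 2)%Z 1 3.
Proof.
rewrite {1 2}(divz_eq k 2); case: (k %/ 2)%Z => m.
  by rewrite addrC torsion_parity.
rewrite -(torsion_parity _ m.+1) addrAC -mulrDl NegzE addNr mul0r add0r.
by [].
Qed.

Lemma rank4_comm k i j : r = 4 -> 0 < i -> i.+1 < j -> j < r ->
  cm k i j = cm (k %% 2)%Z 1 3.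
Proof.
move=> r4 i0 ij jr; have [-> ->] : i = 1%N /\ j = 3 by lia.
exact: torsion_parityz.
Qed.

Lemma H2_rank4_odd : r = 4 -> odd e ->
  zmod_iso (group_homology K 2) (int * int * 'Z_2)%type.
Proof.
move=> r4 e_odd; apply: H2_one_torsion => k i j i0 ij jr.
rewrite rank4_comm //; have [|] : (k %% 2 = 0)%Z \/ (k %% 2 = 1)%Z by lia.
  by move=> ->.
(* Conjugation by [al] shifts the index by the odd number [e] and so joins the two parities. *)
move=> ->; rewrite -(lift_comm_shift_al piM piC sK gP r_gt2 1%R) //.
rewrite torsion_parityz; congr (cm _ 1 3); lia.
Qed.

(** Conjugation by [al] now preserves parity, and the commutators at [k = 0] and [k = 1] give
    independent classes: the two leaf functionals, corrected on [qB], form the dual basis. *)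
Lemma H2_rank4_even : r = 4 -> ~~ odd e ->
  zmod_iso (group_homology K 2) (int * int * ('Z_2 * 'Z_2))%type.
Proof.
move=> r4 e_even; have [qT [qB [phi [j [TE BE jP jE]]]]] :=
  free_part e_gt0 r_gt2.
have [q0 [q0E bq0 q02]] := torsion_class 0%R.
have [q1 [q1E bq1 q12]] := torsion_class 1%R.
have [n [E EP]] := clifford_matrices 'F_3 r; have R3 := natr_mx_F3 n.
have phi0 q : (q *+ 2 = 0)%R -> phi q = 0%R by exact: torsion_int2.
have phiT : phi qT = (1, 0)%R.
  by case: jP => _ jK; rewrite -(jK (1, 0)%R) jE mulr0z addr0.
have phiB : phi qB = (0, 1)%R.
  by case: jP => _ jK; rewrite -(jK (0, 1)%R) jE mulr0z add0r.
(* spin_leaf_functional takes the value 1 on qB, whence the correction. *)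
have leaf (p : bool) : exists f : {additive Q -> 'Z_2},
    [/\ f qT = 0%R, f qB = 0%R, f q0 = (p : nat)%:R%R & f q1 =
      (~~ p : nat)%:R%R].
  have [f [F fP]] := spin_leaf_functional e_gt0 r_gt1 EP R3 p r4 e_even.
  have [|h hE] := additive_of (f := fun q : Q => (f q - (phi q).2%:~R)%R).
    by move=> u v; rewrite /= !raddfB addrACA.
  exists h; rewrite !hE phiT phiB !phi0 // !subr0; split.
  - by apply: (eval_torus fP r_gt2 TE); rewrite comm1g central_fun0.
  - have -> : f qB = 1%R; last by rewrite subrr.
    apply: (eval_quad r_gt1 fP r_gt2 BE) => [k|].
      rewrite /spin_leaf /=; case: ifP => _; last exact: (spin_gen_braid EP R3).
      exact/esym/(spin_gen_braid EP R3)/ltnW.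
    rewrite /spin_leaf /=; case: p {fP} => /=;
      first exact: (spin_leaf_comm EP R3).
    by rewrite (spin_gen_comm EP R3) ?r4.
  - apply: (eval_comm fP (k := 0%R) (i := 1%N) (j := 3)) => //.
    rewrite /spin_leaf /=; case: p {fP};
      last by rewrite commgg -[RHS]/(spin_center R3 0%R) central_fun0.
    exact: (spin_gen_commg EP R3).
  apply: (eval_comm fP (k := 1%R) (i := 1%N) (j := 3)) => //.
  rewrite /spin_leaf /=; case: p {fP};
    first by rewrite commgg -[RHS]/(spin_center R3 0%R) central_fun0.
  exact: (spin_gen_commg EP R3).
have [h0 [h0T h0B h00 h01]] := leaf true;
  have [h1 [h1T h1B h10 h11]] := leaf false.
have [i0 hi0 i0E] := dual_pair_Z2 bq0 q02 h00.
have [i1 hi1 i1E] := dual_pair_Z2 bq1 q12 h11.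
have [||h [i [hiP hE iE]]] := dual_pair_prod hi0 hi1.
- by move=> b; rewrite i0E raddfMn h10 mul0rn.
- by move=> b; rewrite i1E raddfMn h01 mul0rn.
have [||Phi [J [JP _ JE]]] := dual_pair_prod jP hiP.
- move=> [a b]; rewrite hE jE !raddfD !raddfMz h0T h0B h1T h1B !mul0rz !addr0.
  by [].
- move=> [a b]; rewrite iE i0E i1E raddfD !raddfMn.
  by rewrite (torsion_int2 _ q02) (torsion_int2 _ q12) !mul0rn addr0.
apply: (H2_iso_rels e_gt0 r_gt1 JP) => psi psi0.
apply: (push_kernel_rels e_gt0 r_gt2 TE _ BE).
- by have := psi0 (1, 0, (0, 0))%R; rewrite JE jE iE i0E i1E mulr0z !addr0.
- by have := psi0 (0, 1, (0, 0))%R;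
    rewrite JE jE iE i0E i1E mulr0z add0r !addr0.
move=> k i' j' i'0 ij jr; rewrite rank4_comm //.
have [->|->] : (k %% 2 = 0)%Z \/ (k %% 2 = 1)%Z by lia.
  exists q0; split=> //.
  by have := psi0 (0, 0, (1, 0))%R;
    rewrite JE jE iE i0E i1E !mulr0z !add0r addr0.
exists q1; split=> //.
by have := psi0 (0, 0, (0, 1))%R; rewrite JE jE iE i0E i1E !mulr0z !add0r.
Qed.
End TorsionClasses.

(** * Rank 2 *)

Lemma quad_seq_commute (H : groupType) (x y : H) k : commute x y ->
  quad_seq x y k = if (k %% 2)%Z == 0%R then x else y.
Proof.
move=> xy; apply: conj_commute; apply: commute_zpow.
case: ifP => _; first by apply: commuteM.
by apply: commuteM => //; apply: commute_sym.
Qed.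

Section CentralQuadSeq.
Variables (A : zmodType) (G : groupType) (iota : central_emb A G).

Lemma quad_seq_central x y a b k :
  quad_seq (x * iota a) (y * iota b) k =
  quad_seq x y k * iota (if (k %% 2)%Z == 0%R then a else b).
Proof.
rewrite /quad_seq central_mulM.
have zE m : zpow (x * y * iota (a + b)%R) m =
  zpow (x * y) m * iota ((a + b) *~ m)%R.
  elim/int_step_ind: m => [|m]; first by rewrite mulr0z central_fun0 mulg1.
  rewrite !zpowS mulrzDr mulr1z -(central_mulM iota _ _ (zpow (x * y) m)).
  by split=> [->//|]; exact: mulIg.
by rewrite zE; case: (_ == _); rewrite central_conjg.
Qed.

(** For [e] even the correction vanishes and the defects do not depend on the lifts. For [e] odd it
    is [b - c] at 0 and [c - b] at 1: one defect can be normalised away, and a single class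
    remains. *)
Lemma quad_defect_centralM e al x y a b c k :
  quad_defect e (al * iota a) (x * iota b) (y * iota c) k =
  quad_defect e al x y k *
    iota ((if (k %% 2)%Z == 0%R then b else c) -
          (if ((k + Posz e) %% 2)%Z == 0%R then b else c))%R.
Proof.
rewrite /quad_defect !quad_seq_central.
have invE u d : (u * iota d)^-1 = u^-1 * iota (- d)%R.
  by rewrite invgM -central_funN central_funC.
by rewrite !invE central_conjg central_mulM [(- _ + _)%R]addrC.
Qed.
Lemma central_inv x a : (x * iota a)^-1 = x^-1 * iota (- a)%R.
Proof. by rewrite invgM -central_funN central_funC. Qed.

Lemma central_exp x a n : (x * iota a) ^+ n = x ^+ n * iota (a *+ n)%R.
Proof.
elim: n => [|n IHn]; first by rewrite central_fun0 mulg1.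
by rewrite !expgS IHn central_mulM -mulrS.
Qed.

(** For [e = 2 m + 1] the term of index [e] is [y ^ ((x * y) ^+ m)], so this solves the vanishing of
    the defect at 0 for [y]. Any lift [z] may replace [y] in the exponent, where only its image
    matters. *)
Definition odd_lift m (al x z : G) := (x ^ al^-1) ^ ((x * z) ^+ m)^-1.

Lemma odd_lift_central m al x z a b c :
  odd_lift m (al * iota a) (x * iota b) (z * iota c) =
    odd_lift m al x z * iota b.
Proof.
by rewrite /odd_lift central_mulM central_exp !central_inv !central_conjg.
Qed.
End CentralQuadSeq.

Lemma odd_lift_morph (H H' : groupType) (f : H -> H') m al x z :
  {morph f : x y / x * y} ->
    f (odd_lift m al x z) = odd_lift m (f al) (f x) (f z).
Proof.
move=> fM; rewrite /odd_lift !(morph_conj fM) !(morph_inv fM) (morph_exp fM).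
by rewrite fM.
Qed.

Section WeylQuadSeq.
Local Notation sg := weyl_gen.
Local Notation Y k := (weyl_conj k 1).
Local Notation ce := weyl_center.
Local Notation D := (Y 0%R * Y 1%R).

Lemma weyl_conj_prod (n : nat) : Y (Posz n) * Y (Posz n + 1)%R = D * ce n.
Proof.
elim: n => [|n IHn]; first by rewrite add0r central_fun0 mulg1.
have -> : (Posz n.+1 = Posz n + 1)%R by lia.
have -> : (Posz n + 1 + 1 = Posz n + 2)%R by lia.
by rewrite weyl_conj_quad IHn central_funD [RHS]mulgA.
Qed.

(** The conjugates [Y k] form a [quad_seq] only up to the center: by [weyl_conj_quad], each shift by
    2 contributes one central factor. *)
Lemma weyl_conj_period (n j : nat) : Y (Posz (n + j * 2)) =
  Y n ^ (D ^+ j) * ce j.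
Proof.
elim: j => [|j IHj]; first by rewrite addn0 conjg1 central_fun0 mulg1.
have stepE (k : nat) : Y (Posz k + 2)%R = Y k ^ D * ce 1%R.
  have <- : Y k ^ (Y k * Y (Posz k + 1)%R) = Y k ^ D.
    by rewrite weyl_conj_prod -[in LHS](mulg1 (Y k)) -(central_fun0 ce)
      central_conjg
      central_fun0 mulg1.
  rewrite conjgM [Y k ^ Y k]conjgE mulKg conjgE -mulgA -weyl_conj_quad mulKg.
  by [].
have -> : Posz (n + j.+1 * 2) = (Posz (n + j * 2) + 2)%R by lia.
rewrite stepE IHj -(mulg1 D) -(central_fun0 ce) central_conjg central_fun0
  mulg1.
rewrite -mulgA -central_funD -conjgM -expgSr; congr (_ * ce _); lia.
Qed.

Variables (e : nat) (c : int).
Local Notation al := (sg 0 ^+ e * weyl_shift (fun=> c)).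

Lemma weyl_conj_al k : Y k ^ al^-1 = Y (k + Posz e)%R * ce c.
Proof.
set h := weyl_shift (fun=> c).
have hC : h ^ (zpow (sg 0) k)^-1 = h.
  apply: conj_commute; apply: commuteV; apply: commute_zpow.
  apply: eqbij_eq => -[x m]; congr pair => /=.
  by apply/funext => j; rewrite addrAC.
have hY : h * Y k = Y k * h * ce c.
  rewrite [h * _]commgC; congr (_ * _);
    rewrite weyl_conjE -hC -conjRg weyl_shift_const //.
  exact: (central_conj _ (central_funC ce c)).
rewrite invgM conjgM [Y k ^ _]conjgE invgK [h * _]mulgA hY.
have -> : Y k * h * ce c * h^-1 = Y k * ce c.
  by rewrite -!mulgA (central_funC ce c) mulVKg.
rewrite conjMg (central_conj _ (central_funC ce c)) !weyl_conjE -conjgM.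
by rewrite [(k + _)%R]addrC zpowD invgM.
Qed.

Lemma weyl_odd_lift m : e = (m * 2).+1 ->
  odd_lift m al (Y 0%R) (Y 1%R) = Y 1%R * ce (Posz m + c)%R.
Proof.
move=> eE; rewrite /odd_lift weyl_conj_al add0r.
have -> : Posz e = Posz (1 + m * 2) by rewrite eE.
rewrite weyl_conj_period -mulgA -central_funD conjMg conjgK.
by rewrite (central_conj _ (central_funC ce _)).
Qed.

Lemma weyl_odd_defect m : e = (m * 2).+1 ->
  quad_defect e al (Y 0%R) (Y 1%R) 1%R = ce (c + Posz m.+1)%R.
Proof.
move=> eE; rewrite /quad_defect quad_seq1 weyl_conj_al.
have -> : (1 + Posz e)%R = (0 + Posz (m.+1 * 2))%R by rewrite eE; lia.
rewrite quad_seqM2 quad_seq0 add0r -[(m.+1 * 2)%N]add0n weyl_conj_period.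
by rewrite -[_ * ce _ * ce _]mulgA mulKg -central_funD addrC.
Qed.
End WeylQuadSeq.

Section Rank2.
Variables (e : nat).
Hypothesis e_gt0 : 0 < e.
Local Notation K := (complex_braid_group e 2).
Local Notation Q := (bar_coker K).
Local Notation tau := (univ_cocycle K).
Local Notation s := (cext_sec tau).
Local Notation g := (braid_y e 2).
Local Notation al := (braid_al e 2).
Let r_gt1 : 1 < 2 := isT.
Let gP : kernel_rels e 2 al g := kernel_braid_rels r_gt1 e_gt0.
Local Notation y0 := (g 0%R 1%N).
Local Notation y1 := (g 1%R 1%N).

Lemma univ_theta_quad_seq x y k (m : nat) :
  univ_theta (quad_seq x y (k + Posz (m * 2)%N)%R : cext tau) =
  univ_theta (quad_seq x y k : cext tau).
Proof. by rewrite quad_seqM2 univ_thetaJ. Qed.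

Lemma push_quad_rels (psi : {additive Q -> Q}) (x y : cext tau) q0 q1 :
  cext_pi x = y0 -> cext_pi y = y1 ->
  quad_defect e (s al) x y 0%R = cext_in tau q0 -> psi q0 = 0%R ->
  quad_defect e (s al) x y 1%R = cext_in tau q1 -> psi q1 = 0%R ->
  exists (al' : cext (cocycle_push tau psi)) y',
      [/\ kernel_rels e 2 al' y', al'.1 = al &
          forall k i, 0 < i < 2 -> (y' k i).1 = g k i].
Proof.
move=> xE yE q0E q00 q1E q10; pose P := push_map psi.
have PM : {morph P : u v / u * v} := @push_mapM _ psi.
exists (P (s al)), (fun k _ => quad_seq (P x) (P y) k); split=> //.
  apply: (quad_kernel_rels (@cext_piM _ _ _) (@cext_central _ _ _) gP) => //.
  - by rewrite -(quad_defect_morph _ _ _ _ _ PM); apply: (push_map_kill q0E).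
  - by rewrite -(quad_defect_morph _ _ _ _ _ PM); apply: (push_map_kill q1E).
move=> k [|[|i]] // _.
exact: (pi_quad_seq (@cext_piM _ _ _) gP).
Qed.

Lemma quad_defect_class k (x y : cext tau) :
  cext_pi x = y0 -> cext_pi y = y1 ->
  univ_theta (quad_seq x y (k + Posz e)%R : cext tau) =
  univ_theta (quad_seq x y k : cext tau) ->
  exists q, quad_defect e (s al) x y k = cext_in tau q /\ bar_coker_bd q = 0%R.
Proof.
move=> xE yE th; apply: cycle_class.
  rewrite /quad_defect cext_piM (morph_inv (@cext_piM _ _ _)) (morph_conj
    (@cext_piM _ _ _)).
  rewrite (morph_inv (@cext_piM _ _ _)) !(pi_quad_seq (@cext_piM _ _ _) gP) //.
  by rewrite cext_secK conjgE invgK [al * _]mulgA (rel_conj gP) // mulgK mulVg.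
by rewrite /quad_defect univ_thetaM univ_thetaV (univ_thetaJ (quad_seq x y k))
  th addNr.
Qed.

Local Notation sg := weyl_gen.

Section Even.
Hypothesis e_even : ~~ odd e.

(** The indices of one parity are sent to 1, so that consecutive terms commute and the functional
    sees the defect at the other parity only. *)
Definition weyl_leaf (p : bool) (k : int) (i : nat) : eqbij weyl_center_fun :=
  if ((k %% 2)%Z == 0%R) == p then sg 1 else 1.

Lemma weyl_leaf_functional p : exists (phi : {additive Q -> int}) Phi,
  evaluation (e := e) (r :=
    2) weyl_center (weyl_shift (fun=> 1%R)) (weyl_leaf p) phi Phi.
Proof.
have parS k : ((k + 1) %% 2)%Z == 0%R = ~~ ((k %% 2)%Z == 0%R) by lia.
have par2 k : ((k + 2) %% 2)%Z == 0%R = ((k %% 2)%Z == 0%R) by lia.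
apply: (bar_functional r_gt1 e_gt0 (iota := weyl_center));
  apply: cquot_kernel_rels.
- move=> k; exists 0%R; rewrite central_fun0 mulg1 /weyl_leaf parS par2.
  by case: (_ == 0%R); case: p; rewrite /= ?mul1g ?mulg1.
- by move=> k [|[|i]].
- by move=> k [|[|i]].
- by move=> k [|i] [|[|j]].
move=> k i _; rewrite /weyl_leaf.
have -> : ((k + Posz e) %% 2)%Z == 0%R = ((k %% 2)%Z == 0%R) by lia.
case: ifP => _; last by exists 0%R; rewrite central_fun0 !mulg1 mul1g.
exists (- 1)%R; rewrite [weyl_shift _ * _]commgC weyl_shift_const // -mulgA
  -central_funD.
by rewrite subrr central_fun0 mulg1.
Qed.

Lemma H2_rank2_even : zmod_iso (group_homology K 2) (int * int)%type.
Proof.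
have [m eE] : exists m, e = (m * 2)%N by exists e./2; lia.
(* Since [e] is even, the term of index [k + e] is a conjugate of that of index [k], which makes the
   defect a cycle. *)
have th k : univ_theta (quad_seq (s y0) (s y1) (k + Posz e)%R : cext tau) =
    univ_theta (quad_seq (s y0) (s y1) k : cext tau).
  by rewrite [in (k + _)%R](congr1 Posz eE) univ_theta_quad_seq.
have [q0 [q0E bq0]] := quad_defect_class (cext_secK _ _) (cext_secK _ _) (th
  0%R).
have [q1 [q1E bq1]] := quad_defect_class (cext_secK _ _) (cext_secK _ _) (th
  1%R).
have leaf (p : bool) : exists f : {additive Q -> int},
    f q0 = (p : nat)%:R%R /\ f q1 = (~~ p : nat)%:R%R.
  have [f [F [FM Fin [a aE] Fy]]] := weyl_leaf_functional p; exists f.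
  have [[b bE] [c cE]] := (Fy 0%R 1%N isT, Fy 1%R 1%N isT).
  have L0 : weyl_leaf p 0%R 1 = if p then sg 1 else 1 by case: (p).
  have L1 : weyl_leaf p 1%R 1 = if p then 1 else sg 1 by case: (p).
  have evalE k q : quad_defect e (s al) (s y0) (s y1) k = cext_in tau q ->
      weyl_center (f q) = quad_defect e (weyl_shift (fun=> 1%R))
        (weyl_leaf p 0%R 1) (weyl_leaf p 1%R 1) k.
    move=> qE; rewrite -Fin -qE (quad_defect_morph _ _ _ _ _ FM) aE bE cE.
    rewrite quad_defect_centralM.
    have -> : ((k + Posz e) %% 2)%Z == 0%R = ((k %% 2)%Z == 0%R) by lia.
    by rewrite subrr central_fun0 mulg1.
  have defectE x y k : commute x y ->
    quad_defect e (weyl_shift (fun=> 1%R)) x y k =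
      if (k %% 2)%Z == 0%R then [~ x, (weyl_shift (fun=> 1%R))^-1]
      else [~ y, (weyl_shift (fun=> 1%R))^-1].
    move=> xy; rewrite /quad_defect !quad_seq_commute //.
    have -> : ((k + Posz e) %% 2)%Z == 0%R = ((k %% 2)%Z == 0%R) by lia.
    by case: ifP.
  have sgE : [~ sg 1, (weyl_shift (fun=> 1%R))^-1] = weyl_center 1%R.
    rewrite commgEl conjgE invgK [weyl_shift _ * _]mulgA [weyl_shift _ * sg
      1]commgC.
    rewrite weyl_shift_const //.
    by rewrite -!mulgA mulKg (central_funC weyl_center) mulVKg.
  have C0 : commute (weyl_leaf p 0%R 1) (weyl_leaf p 1%R 1).
    by rewrite L0 L1; case: (p); rewrite /commute ?mulg1 ?mul1g.
  split; apply: (@central_fun_inj _ _ weyl_center).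
    rewrite (evalE 0%R) // defectE // L0; case: (p); first exact: sgE.
    by rewrite comm1g -[RHS]/(weyl_center 0%R) central_fun0.
  rewrite (evalE 1%R) // defectE // L1; case: (p); last exact: sgE.
  by rewrite comm1g -[RHS]/(weyl_center 0%R) central_fun0.
have [f [f0 f1]] := leaf true; have [h [h0 h1]] := leaf false.
have [i fi iE] := dual_pair_int bq0 f0; have [j hj jE] := dual_pair_int bq1 h1.
have [||phi [J [JP _ JE]]] := dual_pair_prod fi hj.
- by move=> a; rewrite iE raddfMz h0 mul0rz.
- by move=> b; rewrite jE raddfMz f1 mul0rz.
apply: (H2_iso_rels e_gt0 r_gt1 JP) => psi psi0.
apply: (push_quad_rels (cext_secK _ _) (cext_secK _ _) q0E _ q1E).
- by have := psi0 (1, 0)%R; rewrite JE iE jE mulr0z addr0.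
by have := psi0 (0, 1)%R; rewrite JE iE jE mulr0z add0r.
Qed.
End Even.
Section Odd.
Variable m : nat.
Hypothesis eE : e = (m * 2).+1.

(* y1 is lifted in such a way that the defect vanishes at 0. *)
Local Notation y := (odd_lift m (s al) (s y0) (s y1)).

Lemma pi_odd_lift : cext_pi y = y1.
Proof.
rewrite (odd_lift_morph _ _ _ _ (@cext_piM _ _ tau)) !cext_secK /odd_lift.
have gE k : quad_seq y0 y1 k = g k 1%N.
  by apply: (pi_quad_seq (pi := id) _ gP) => // u v ->; apply: commute_sym;
    apply: commute1.
have -> : y0 ^ al^-1 = g (0 + Posz e)%R 1%N.
  by apply: (@conjg_inj _ al); rewrite conjgKV (kernel_rel_conj gP).
have -> : (0 + Posz e = 1 + Posz (m * 2))%R by rewrite eE; lia.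
by rewrite -gE quad_seqM2 quad_seq1 conjgK.
Qed.

Lemma odd_lift_defect : quad_defect e (s al) (s y0) y 0%R = 1.
Proof.
rewrite /quad_defect quad_seq0.
have -> : (0 + Posz e = 1 + Posz (m * 2))%R by rewrite eE; lia.
rewrite quad_seqM2 quad_seq1.
have -> : y ^ (s y0 * y) ^+ m = y ^ (s y0 * s y1) ^+ m.
  apply: (lift_conj (@cext_piM _ _ tau) (@cext_central _ _ tau)).
  by rewrite !(morph_exp (@cext_piM _ _ tau)) (cext_piM (s y0) (s y1))
    (cext_piM _ y) pi_odd_lift.
by rewrite conjgKV mulVg.
Qed.

Lemma H2_rank2_odd : zmod_iso (group_homology K 2) int.
Proof.
have [|q [qE bq]] := @quad_defect_class 1%R (s y0) y (cext_secK _ _)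
  pi_odd_lift.
  (* The term of index [1 + e] is a conjugate of [s y0], and so is the lift [y] of [y1]: the defect
     is a cycle. *)
  have -> : (1 + Posz e)%R = (0 + Posz (m.+1 * 2))%R by rewrite eE; lia.
  by rewrite univ_theta_quad_seq quad_seq0 quad_seq1 !univ_thetaJ.
(* With twist [c], the defect contributes [c + m + 1] and the corrected lift of [y1] contributes
   [m + c]; the sum is 1 exactly for [c = - m]. *)
have [f [F [FM Fin [a aE] Fy]]] := weyl_functional e_gt0 r_gt1 (- Posz m)%R.
have [[b bE] [d dE]] := (Fy 0%R 1%N isT, Fy 1%R 1%N isT).
have fq : f q = 1%R.
  apply: (@central_fun_inj _ _ weyl_center).
  rewrite -Fin -qE (quad_defect_morph _ _ _ _ _ FM) (odd_lift_morph _ _ _ _ FM)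
    aE bE dE.
  rewrite odd_lift_central (weyl_odd_lift _ eE).
  rewrite -[_ * weyl_center _ * _]mulgA -central_funD.
  rewrite quad_defect_centralM (weyl_odd_defect _ eE) -central_funD.
  congr (weyl_center _).
  have -> : ((1 + Posz e) %% 2)%Z == 0%R by lia.
  rewrite /=; lia.
have [j jP jE] := dual_pair_int bq fq.
apply: (H2_iso_rels e_gt0 r_gt1 jP) => psi psi0.
apply: (@push_quad_rels psi (s y0) y 0%R q (cext_secK _ _) pi_odd_lift _ _ qE).
- by rewrite odd_lift_defect cext_in0.
- exact: raddf0.
by have := psi0 1%R; rewrite jE mulr1z.
Qed.
End Odd.
End Rank2.

Local Close Scope group_scope.

Theorem theorem1p4 (e r : nat) (he : (1 <= e)%N) (hr : (2 <= r)%N) :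
  let H2 := group_homology (complex_braid_group e r) 2 in
  (r = 2 -> odd e -> zmod_iso H2 int) /\
  (r = 2 -> ~~ odd e -> zmod_iso H2 (int * int)%type) /\
  (r = 3 -> zmod_iso H2 (int * int)%type) /\
  (r = 4 -> odd e -> zmod_iso H2 (int * int * 'Z_2)%type) /\
  (r = 4 -> ~~ odd e -> zmod_iso H2 (int * int * ('Z_2 * 'Z_2))%type) /\
  ((5 <= r)%N -> zmod_iso H2 (int * int * 'Z_2)%type).
Proof.
have ge3 n : r = n.+3 -> 2 < r by move=> ->.
split; first by move=> r2 e_odd; subst r; apply: (@H2_rank2_odd e he e./2); lia.
split; first by move=> r2 e_even; subst r; apply: (H2_rank2_even he).
split; first by move=> r3; apply: (H2_rank3 he (ge3 0 r3)).
split; first by move=> r4; apply: (H2_rank4_odd he (ge3 1 r4)); lia.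
split; first by move=> r4; apply: (H2_rank4_even he (ge3 1 r4)); lia.
by move=> r5; apply: (H2_rank_ge5 he (ltnW (ltnW r5))); lia.
Qed.
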